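(* Let $X$ be a real Banach space with $\dim X\ge 2$ and let $H$ be a real Hilbert space with $\dim H\ge 2$. Then for every $\varepsilon>0$ $$\zeta_X^-(\varepsilon)\le \zeta_H^-(\varepsilon)=\sqrt{1+\varepsilon^2}=\zeta_H^+(\varepsilon)\le \zeta_X^+(\varepsilon).$$
   Context: For a real Banach space $X$, $\partial B$ denotes its unit sphere. For $x\in X\setminus\{0\}$, a vector $y$ is called quasi-orthogonal to $x$, written $y\urcorner x$, if there is a functional $p\in X^*$ with $\|p\|=1$, $\langle p,x\rangle=\|x\|$ and $\langle p,y\rangle=0$ (equivalently, $\|x+\lambda y\|\ge\|x\|$ for all $\lambda\in\mathbb{R}$). For $\varepsilon>0$ define $$\zeta_X^-(\varepsilon)=\inf\{\|x+\varepsilon y\|: x,y\in\partial B,\ y\urcorner x\},\qquad \zeta_X^+(\varepsilon)=\sup\{\|x+\varepsilon y\|: x,y\in\partial B,\ y\urcorner x\}.$$ *)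

(* Defs.v *)
From HB Require Import structures.
From mathcomp Require Import all_boot all_order all_algebra.
From mathcomp Require Import all_classical all_reals all_analysis.

Set Implicit Arguments.
Unset Strict Implicit.
Unset Printing Implicit Defensive.

Import Order.TTheory GRing.Theory Num.Theory.
Import numFieldNormedType.Exports.

Local Open Scope classical_set_scope.
Local Open Scope ring_scope.

(* The dimension may be infinite. *)
Definition dim_geq (R : realType) (X : normedModType R) (n : nat) : Prop :=
  exists e : 'I_n -> X, forall c : 'I_n -> R,
    \sum_(i < n) c i *: e i = 0 -> forall i, c i = 0.

Definition unit_sphere (R : realType) (X : normedModType R) : set X :=
  [set x | `|x| = 1].

(* The dual norm; only meaningful for continuous p, because the supremum of an
   unbounded set of reals is 0 by convention. *)
Definition functional_norm (R : realType) (X : normedModType R)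
    (p : {linear X -> R^o}) : R :=
  sup [set `|p x| | x in [set x : X | `|x| <= 1]].

(* quasi_orthogonal x y is "y is quasi-orthogonal to x"; this relation is not
   symmetric. *)
Definition quasi_orthogonal (R : realType) (X : normedModType R) (x y : X)
    : Prop :=
  exists p : {linear X -> R^o},
    [/\ continuous p, functional_norm p = 1, p x = `|x| & p y = 0].

Definition zeta_set (R : realType) (X : normedModType R) (eps : R) : set R :=
  [set r | exists x y : X, [/\ unit_sphere x, unit_sphere y,
     quasi_orthogonal x y & r = `|x + eps *: y|]].

(* For eps > 0, zeta_set X eps lies in [0, 1 + eps], and it is nonempty when
   dim X >= 2 by Hahn-Banach; the default value 0 of inf and sup is then not
   used. *)
Definition zeta_minus (R : realType) (X : normedModType R) (eps : R) : R :=
  inf (zeta_set X eps).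

Definition zeta_plus (R : realType) (X : normedModType R) (eps : R) : R :=
  sup (zeta_set X eps).

(* {dot H for idfun} is the type of positive definite symmetric bilinear forms
   on H; completeness of H comes from its type. *)
Definition is_hilbert (R : realType) (H : completeNormedModType R) : Prop :=
  exists dot : {dot H for idfun}, forall x : H, `|x| = Num.sqrt (dot x x).

(* Main.v *)
Require Import Defs.
From HB Require Import structures.
From mathcomp Require Import all_boot all_order all_algebra.
From mathcomp Require Import all_classical all_reals all_analysis.
From mathcomp Require Import ring lra.

Set Implicit Arguments.
Unset Strict Implicit.
Unset Printing Implicit Defensive.

Import Order.TTheory GRing.Theory Num.Theory.
Import numFieldNormedType.Exports.

Local Open Scope classical_set_scope.
Local Open Scope ring_scope.

(** A quasi-orthogonal pair in a Hilbert space is orthogonal, so there every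
    value |x + eps y| is c = sqrt (1 + eps^2), and the two middle equalities
    follow once one such pair exists.  What remains concerns X alone: pairs with
    |x + eps y| <= c + d and pairs with |x + eps y| >= c - d exist for every
    d > 0.  This only involves a plane of X: Hahn-Banach turns the inequality
    |x + t y| >= |x| (all t), checked in that plane, into a functional on X
    ([birkhoff_quasi_orthogonal]).

    In the plane the argument is Mamikon's theorem.  Let B be the unit ball.
    From a boundary point x of B follow the supporting line in its direction y
    until it meets the boundary of c B, at z = x + r y with r > 0.  When the
    pair (x, y) makes a full turn, x and y both run once around the boundary of
    B and z runs once around that of c B.  Write u ^ v for the determinant of u
    and v; since dx is parallel to y,
      z ^ dz = x ^ dx + r^2 (y ^ dy) + d (r (x ^ y)) - 2 r (dx ^ y)
             = x ^ dx + r^2 (y ^ dy) + d (r (x ^ y)).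
    Integration gives (c^2 - 1) A = \oint r^2 (y ^ dy), where A > 0 is twice the
    area of B, and y ^ dy >= 0 has integral A.  As c^2 - 1 = eps^2, the number
    eps^2 is a mean value of r^2: neither r >= eps + d nor r <= eps - d can hold
    for all pairs ([chord_lower_bound], [chord_upper_bound]).  Because
    t |-> |x + t y| is convex with minimum 1 at t = 0 and value c at t = r,
    comparing r with eps is comparing c with |x + eps y|
    ([exists_orthogonal_le], [exists_orthogonal_ge]).

    For a norm that is neither smooth nor strictly convex, x does not determine
    y, nor y x.  The pairs are therefore parametrized by s = al + be, the sum of
    the polar angles al of x and be of y.  For every s there is exactly one pair
    ([orthogonal_angles_exist], [orthogonal_angles_le]), and both angles are
    nondecreasing in s, hence 1-Lipschitz.  All quantities above are then
    Lipschitz in s, the identity holds up to errors of order (t - s)^2 between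
    parameters s and t ([chord_area]), and the total of such errors over
    a subdivision vanishes with its mesh ([le_of_quadratic_defect]). *)

(** * Lipschitz functions, quadratic errors and polar angles *)

Definition lip_on (R : realType) (a b : R) (f : R -> R) : Prop :=
  exists2 K, 0 <= K & forall s t, a <= s <= b -> a <= t <= b ->
    `|f s - f t| <= K * `|s - t|.

(** The defects [f s t] that are negligible when summed over a fine
    subdivision. *)
Definition quad_on (R : realType) (a b : R) (f : R -> R -> R) : Prop :=
  exists2 C, 0 <= C & forall s t, a <= s <= b -> a <= t <= b ->
    `|f s t| <= C * (s - t) ^+ 2.

Lemma lip_on_bounded (R : realType) (a b : R) (f : R -> R) :
  lip_on a b f -> exists2 B, 0 <= B & forall s, a <= s <= b -> `|f s| <= B.
Proof.
move=> [K K0 Kf]; have [ab|ba] := leP a b; last first.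
  by exists 0 => // s sab; exfalso; lra.
exists (`|f a| + K * (b - a)) => [|s sab].
  by rewrite addr_ge0// mulr_ge0// subr_ge0.
have /(Kf s a sab) : a <= a <= b by rewrite lexx.
rewrite -{2}(subrK (f a) (f s)) => fsa.
apply: (le_trans (ler_normD _ _)); rewrite addrC lerD2l (le_trans fsa)//.
by rewrite ler_wpM2l// ger0_norm; lra.
Qed.

Lemma lip_on_cst (R : realType) (a b c : R) : lip_on a b (fun=> c).
Proof. by exists 0 => // s t _ _; rewrite subrr normr0 mul0r. Qed.

Lemma lip_onD (R : realType) (a b : R) (f g : R -> R) :
  lip_on a b f -> lip_on a b g -> lip_on a b (fun s => f s + g s).
Proof.
move=> [K K0 fK] [L L0 gL]; exists (K + L) => [|s t sab tab].
  exact: addr_ge0.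
have -> : f s + g s - (f t + g t) = (f s - f t) + (g s - g t) by ring.
by rewrite mulrDl (le_trans (ler_normD _ _))// lerD ?fK ?gL.
Qed.

Lemma lip_onN (R : realType) (a b : R) (f : R -> R) :
  lip_on a b f -> lip_on a b (fun s => - f s).
Proof.
move=> [K K0 fK]; exists K => // s t sab tab.
by rewrite -opprD normrN fK.
Qed.

Lemma lip_onM (R : realType) (a b : R) (f g : R -> R) :
  lip_on a b f -> lip_on a b g -> lip_on a b (fun s => f s * g s).
Proof.
move=> fl gl; have [B B0 fB] := lip_on_bounded fl.
have [D D0 gD] := lip_on_bounded gl; case: fl gl => [K K0 fK] [L L0 gL].
exists (K * D + B * L) => [|s t sab tab]; first by rewrite addr_ge0 ?mulr_ge0.
have -> : f s * g s - f t * g t = (f s - f t) * g s + f t * (g s - g t) by ring.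
apply: (le_trans (ler_normD _ _)); rewrite !normrM mulrDl.
have -> : K * D * `|s - t| = K * `|s - t| * D by ring.
rewrite -[B * L * _]mulrA.
by rewrite lerD// ler_pM// ?fK ?gL ?gD ?fB.
Qed.

Lemma inv_dist_le (R : realType) (m x y : R) : 0 < m -> m <= x -> m <= y ->
  `|x^-1 - y^-1| <= m^-1 ^+ 2 * `|x - y|.
Proof.
move=> m0 mx my; have x0 := lt_le_trans m0 mx; have y0 := lt_le_trans m0 my.
have -> : x^-1 - y^-1 = x^-1 * y^-1 * (y - x) by field; rewrite !gt_eqF.
rewrite normrM (distrC y) ler_wpM2r// gtr0_norm ?mulr_gt0 ?invr_gt0// expr2.
by rewrite ler_pM ?invr_ge0 ?(ltW x0) ?(ltW y0)// lef_pV2 ?posrE.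
Qed.

Lemma lip_onV (R : realType) (a b m : R) (f : R -> R) : 0 < m ->
  (forall s, a <= s <= b -> m <= f s) -> lip_on a b f ->
  lip_on a b (fun s => (f s)^-1).
Proof.
move=> m0 fm [K K0 fK]; exists (m^-1 ^+ 2 * K) => [|s t sab tab].
  by rewrite mulr_ge0// sqr_ge0.
rewrite (le_trans (inv_dist_le m0 (fm s sab) (fm t tab)))// -[leRHS]mulrA.
by rewrite ler_wpM2l ?sqr_ge0// fK.
Qed.

Definition lipschitz_fun (R : realType) (g : R -> R) : Prop :=
  exists2 K, 0 <= K & forall x y, `|g x - g y| <= K * `|x - y|.

Lemma lip_on_comp (R : realType) (a b : R) (g f : R -> R) :
  lipschitz_fun g -> lip_on a b f -> lip_on a b (g \o f).
Proof.
move=> [K K0 gK] [L L0 fL]; exists (K * L) => [|s t sab tab] /=.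
  exact: mulr_ge0.
by rewrite (le_trans (gK _ _))// -mulrA ler_wpM2l// fL.
Qed.

Lemma lipschitz_lip_on (R : realType) (a b : R) (g : R -> R) :
  lipschitz_fun g -> lip_on a b g.
Proof. by move=> [K K0 gK]; exists K => // s t _ _; exact: gK. Qed.

Lemma lipschitz_continuous (R : realType) (g : R -> R) :
  lipschitz_fun g -> continuous g.
Proof.
move=> [K K0 gK] x; apply/cvgrPdist_le => e e0; near=> y.
rewrite (le_trans (gK _ _))//; near: y.
exists (e / (K + 1)) => [|y /= xy]; first by rewrite /= divr_gt0// ltr_wpDl.
rewrite (@le_trans _ _ ((K + 1) * `|x - y|))// ?ler_wpM2r ?lerDl//.
by rewrite -ler_pdivlMl 1?mulrC ?ltW// ltr_wpDl.
Unshelve. all: by end_near. Qed.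

Lemma bounded_derivative_lipschitz (R : realType) (f df : R -> R) (K : R) :
  0 <= K -> (forall x : R, is_derive x 1 f (df x)) ->
  (forall x, `|df x| <= K) -> lipschitz_fun f.
Proof.
move=> K0 fdf dfK; exists K => // x y.
wlog xy : x y / x <= y => [hw|].
  by have /orP[/hw//|/hw] := le_total x y; rewrite distrC (distrC y).
rewrite distrC.
have [|c _ ->] := @MVT_segment _ f df x y xy (fun x _ => fdf x) => [|].
  apply: continuous_subspaceT => z; apply: differentiable_continuous.
  by apply/derivable1_diffP; have [] := fdf z.
by rewrite normrM (distrC x) ler_wpM2r.
Qed.

Lemma sin_lipschitz (R : realType) : lipschitz_fun (@sin R).
Proof.
by apply: (@bounded_derivative_lipschitz _ _ cos 1) => // x; exact: cos_max.
Qed.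

Lemma cos_lipschitz (R : realType) : lipschitz_fun (@cos R).
Proof.
apply: (@bounded_derivative_lipschitz _ _ (fun x => - sin x) 1) => // x.
by rewrite normrN; exact: sin_max.
Qed.

Lemma atan_lipschitz (R : realType) : lipschitz_fun (@atan R).
Proof.
apply: (@bounded_derivative_lipschitz _ _ (fun x => (1 + x ^+ 2)^-1) 1) => // x.
by rewrite ger0_norm ?invr_ge0 ?invf_le1 ?ltr_wpDr ?lerDl ?addr_ge0 ?sqr_ge0.
Qed.

(** The mean value theorem, once for sin t - t and once for cos. *)
Lemma sin_sub_id_le (R : realType) (t : R) : `|sin t - t| <= t ^+ 2.
Proof.
have h : forall x : R, is_derive x 1 (fun x : R => sin x - x) (cos x - 1).
  by move=> x; apply: is_deriveB.
wlog t0 : t / 0 <= t => [hw|].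
  have [/hw//|t0] := leP 0 t; rewrite -sqrrN -normrN.
  have -> : - (sin t - t) = sin (- t) - - t by rewrite sinN; ring.
  by apply: hw; lra.
have [|c] := @MVT_segment _ (fun x : R => sin x - x) (fun x => cos x - 1)
  0 t t0 (fun x _ => h x).
  apply: continuous_subspaceT => z; apply: differentiable_continuous.
  by apply/derivable1_diffP; have [] := h z.
rewrite in_itv/= => /andP[c0 ct]; rewrite sin0 !subr0 => ->.
rewrite normrM (ger0_norm t0) expr2 ler_wpM2r//.
have [|d _] := @MVT_segment _ cos (fun x => - sin x) 0 c c0
  (fun x _ => is_derive_cos x).
  exact/continuous_subspaceT/continuous_cos.
rewrite cos0 subr0 => ->; rewrite normrM normrN (ger0_norm c0).
by rewrite (le_trans _ ct)// -[leRHS]mul1r ler_wpM2r// sin_max.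
Qed.

Lemma quad_onD (R : realType) (a b : R) (f g : R -> R -> R) :
  quad_on a b f -> quad_on a b g -> quad_on a b (fun s t => f s t + g s t).
Proof.
move=> [C C0 fC] [D D0 gD]; exists (C + D) => [|s t sab tab].
  exact: addr_ge0.
by rewrite mulrDl (le_trans (ler_normD _ _))// lerD ?fC ?gD.
Qed.

Lemma quad_onM (R : realType) (a b : R) (f h : R -> R -> R) :
  (exists2 B, 0 <= B & forall s t, a <= s <= b -> a <= t <= b ->
    `|h s t| <= B) ->
  quad_on a b f -> quad_on a b (fun s t => h s t * f s t).
Proof.
move=> [B B0 hB] [C C0 fC]; exists (B * C) => [|s t sab tab].
  exact: mulr_ge0.
by rewrite normrM -mulrA ler_pM// ?hB ?fC.
Qed.

Lemma quad_on_lip (R : realType) (a b : R) (f g : R -> R) :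
  lip_on a b f -> lip_on a b g ->
  quad_on a b (fun s t => (f t - f s) * (g t - g s)).
Proof.
move=> [K K0 fK] [L L0 gL]; exists (K * L) => [|s t sab tab].
  exact: mulr_ge0.
have -> : K * L * (s - t) ^+ 2 = (K * `|s - t|) * (L * `|s - t|).
  by rewrite -[(s - t) ^+ 2]real_normK ?num_real//; ring.
rewrite normrM (distrC (f t)) (distrC (g t)).
by rewrite ler_pM ?fK ?gL.
Qed.

Lemma quad_on_le (R : realType) (a b : R) (f g : R -> R -> R) :
  (forall s t, a <= s <= b -> a <= t <= b -> `|f s t| <= `|g s t|) ->
  quad_on a b g -> quad_on a b f.
Proof.
move=> fg [C C0 gC]; exists C => // s t sab tab.
by rewrite (le_trans (fg _ _ sab tab))// gC.
Qed.

Lemma quad_on_comp (R : realType) (a b a' b' C : R)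
    (f : R -> R -> R) (g : R -> R) :
  0 <= C ->
  (forall s t, a' <= s <= b' -> a' <= t <= b' ->
    `|f s t| <= C * (s - t) ^+ 2) ->
  (forall s, a <= s <= b -> a' <= g s <= b') ->
  lip_on a b g -> quad_on a b (fun s t => f (g s) (g t)).
Proof.
move=> C0 fC gab [K K0 gK]; exists (C * K ^+ 2) => [|s t sab tab].
  by rewrite mulr_ge0 ?sqr_ge0.
rewrite (le_trans (fC _ _ (gab _ sab) (gab _ tab)))// -mulrA ler_wpM2l//.
rewrite -[(g s - g t) ^+ 2]real_normK ?num_real//.
rewrite -[(s - t) ^+ 2]real_normK ?num_real// -exprMn.
by rewrite ler_pXn2r ?nnegrE ?gK// mulr_ge0.
Qed.

(** A discrete substitute for a nonnegative derivative: over n equal steps the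
    defects sum to at most C (b - a)^2 / n. *)
Lemma le_of_quadratic_defect (R : realType) (a b C : R) (F : R -> R) :
  a <= b -> 0 <= C ->
  (forall s t, a <= s -> s <= t -> t <= b ->
    - (C * (s - t) ^+ 2) <= F t - F s) ->
  F a <= F b.
Proof.
move=> ab C0 FC; rewrite -subr_ge0 leNgt; apply/negP => Fab.
pose D := C * (b - a) ^+ 2; pose n := (Num.truncn (D / (F a - F b))).+1.
have D0 : 0 <= D by rewrite mulr_ge0 ?sqr_ge0.
have nD : D < n%:R * (F a - F b).
  by rewrite -ltr_pdivrMr ?truncnS_gt// subr_gt0; lra.
have n0 : 0 < n%:R :> R by rewrite ltr0n.
pose p k := a + (b - a) * (k%:R / n%:R).
have step k : (k < n)%N -> - (D / n%:R ^+ 2) <= F (p k.+1) - F (p k).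
  move=> kn; have -> : D / n%:R ^+ 2 = C * (p k - p k.+1) ^+ 2.
    by rewrite /D /p -natr1; field; rewrite gt_eqF.
  have k0 : 0 <= k%:R / n%:R :> R by rewrite divr_ge0.
  have kS : k%:R / n%:R <= k.+1%:R / n%:R :> R.
    by rewrite ler_pM2r ?invr_gt0// ler_nat.
  have k1 : k.+1%:R / n%:R <= 1 :> R by rewrite ler_pdivrMr// mul1r ler_nat.
  have ba : 0 <= b - a by rewrite subr_ge0.
  apply: FC; rewrite /p; [|by rewrite lerD2l ler_wpM2l|].
    by rewrite lerDl mulr_ge0.
  by rewrite -lerBrDl -[leRHS]mulr1 ler_wpM2l.
have tot k : (k <= n)%N -> - (k%:R * (D / n%:R ^+ 2)) <= F (p k) - F (p 0%N).
  elim: k => [|k IH] kn; first by rewrite mul0r subrr oppr0.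
  by have := lerD (IH (ltnW kn)) (step k kn); rewrite -natr1; lra.
have := tot n (leqnn _).
have -> : p n = b by rewrite /p divff ?gt_eqF//; ring.
have -> : p 0%N = a by rewrite /p mul0r; ring.
have -> : n%:R * (D / n%:R ^+ 2) = D / n%:R by field; rewrite gt_eqF.
have : D / n%:R < F a - F b by rewrite ltr_pdivrMr// mulrC.
lra.
Qed.

(** The radius r may be negative, which is why a half-turn of angles around any
    prescribed center c is enough. *)
Lemma polar_coordinates (R : realType) (a b c : R) : exists r t : R,
  [/\ c - pi / 2 <= t <= c + pi / 2, a = r * cos t & b = r * sin t].
Proof.
pose p := a * cos c + b * sin c; pose q := b * cos c - a * sin c.
have cs := cos2Dsin2 c.
have ap : a = p * cos c - q * sin c.
  have -> : a = a * (cos c ^+ 2 + sin c ^+ 2) by rewrite cs mulr1.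
  by rewrite /p /q; ring.
have bq : b = p * sin c + q * cos c.
  have -> : b = b * (cos c ^+ 2 + sin c ^+ 2) by rewrite cs mulr1.
  by rewrite /p /q; ring.
have pi0 := pi_gt0 R.
have [p0|p0] := eqVneq p 0.
  exists q, (c + pi / 2); rewrite cosDpihalf sinDpihalf; split.
  - by apply/andP; split; lra.
  - by rewrite ap p0; ring.
  - by rewrite bq p0; ring.
pose t := atan (q / p).
have ct : cos t != 0.
  by rewrite gt_eqF// cos_gt0_pihalf// atan_gtNpi2 atan_ltpi2.
have pt : p / cos t * sin t = q.
  have : tan t = q / p by exact: atanK.
  by rewrite /tan mulrAC -mulrA => ->; rewrite mulrCA divff ?mulr1.
exists (p / cos t), (c + t).
have := atan_gtNpi2 (q / p); have := atan_ltpi2 (q / p); rewrite -/t => t1 t2.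
split; first by apply/andP; split; lra.
- by rewrite cosD mulrBr !mulrA [_ * cos c * _]mulrAC divfK//
    (mulrAC _ (sin c)) pt.
- by rewrite sinD mulrDr !mulrA [_ * sin c * _]mulrAC divfK//
    (mulrAC _ (cos c)) pt.
Qed.

(** * Norms on the plane and areas of sectors *)

(** The plane is described by coordinates so that determinants of vectors are
    explicit polynomials. *)
Record planar_norm (R : realType) := PlanarNorm {
  pnorm :> R -> R -> R;
  pnormD : forall a b c d, pnorm (a + c) (b + d) <= pnorm a b + pnorm c d;
  pnormZ : forall t a b, pnorm (t * a) (t * b) = `|t| * pnorm a b;
  pnorm_eq0 : forall a b, pnorm a b = 0 -> a = 0 /\ b = 0 }.

(** The unit sphere is the polar curve with radius [1 / pcirc N t]. *)
Definition pcirc (R : realType) (N : planar_norm R) (t : R) : R :=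
  N (cos t) (sin t).

Lemma pnorm0 (R : realType) (N : planar_norm R) : N 0 0 = 0.
Proof. by have := pnormZ N 0 0 0; rewrite !mul0r normr0 mul0r. Qed.

Lemma pnormN (R : realType) (N : planar_norm R) a b : N (- a) (- b) = N a b.
Proof. by have := pnormZ N (-1) a b; rewrite !mulN1r normrN1 mul1r. Qed.

Lemma pnorm_ge0 (R : realType) (N : planar_norm R) a b : 0 <= N a b.
Proof.
by have := pnormD N a b (- a) (- b); rewrite !subrr pnorm0 pnormN; lra.
Qed.

Lemma pnorm_dist (R : realType) (N : planar_norm R) a b c d :
  `|N a b - N c d| <= N (a - c) (b - d).
Proof.
have := pnormD N (a - c) (b - d) c d; have := pnormD N (c - a) (d - b) a b.
rewrite !subrK -(pnormN N (a - c)) !opprB ler_norml => h1 h2.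
by apply/andP; split; lra.
Qed.

Lemma pnorm_le_coords (R : realType) (N : planar_norm R) :
  exists2 K, 0 <= K & forall a b, N a b <= K * (`|a| + `|b|).
Proof.
exists (N 1 0 + N 0 1) => [|a b]; first by rewrite addr_ge0 ?pnorm_ge0.
have := pnormD N a 0 0 b; rewrite addr0 add0r => h; apply: (le_trans h).
have := pnormZ N a 1 0; have := pnormZ N b 0 1; rewrite !mulr1 !mulr0 => -> ->.
have := pnorm_ge0 N 1 0; have := pnorm_ge0 N 0 1.
have := normr_ge0 a; have := normr_ge0 b; nra.
Qed.

Lemma pcirc_lipschitz (R : realType) (N : planar_norm R) :
  lipschitz_fun (pcirc N).
Proof.
have [K K0 NK] := pnorm_le_coords N; have [L L0 sL] := sin_lipschitz R.
have [M M0 cM] := cos_lipschitz R.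
exists (K * (M + L)) => [|x y]; first by rewrite mulr_ge0// addr_ge0.
rewrite (le_trans (pnorm_dist _ _ _ _ _))// (le_trans (NK _ _))// -mulrA.
by rewrite ler_wpM2l// mulrDl lerD.
Qed.

Lemma pcirc_gt0 (R : realType) (N : planar_norm R) t : 0 < pcirc N t.
Proof.
rewrite lt_neqAle pnorm_ge0 andbT eq_sym; apply/eqP => /pnorm_eq0[c0 s0].
by have := cos2Dsin2 t; rewrite c0 s0; lra.
Qed.

Lemma pcirc_pi (R : realType) (N : planar_norm R) t :
  pcirc N (t + pi) = pcirc N t.
Proof. by rewrite /pcirc cosDpi sinDpi pnormN. Qed.

(** The lower bound is the compactness of the circle; by homogeneity it
    suffices to minimize over a half-turn. *)
Lemma pcirc_bounds (R : realType) (N : planar_norm R) :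
  exists m M, [/\ 0 < m, 0 < M & forall t, m <= pcirc N t <= M].
Proof.
have pi0 := pi_gt0 R.
have hle : - (pi / 2) <= pi / 2 :> R by lra.
have [c _ mc] := @EVT_min _ (pcirc N) _ _ hle
  (continuous_subspaceT (lipschitz_continuous (pcirc_lipschitz N))).
have [K K0 NK] := pnorm_le_coords N.
exists (pcirc N c), (2 * K + 1); split=> [||t]; [exact: pcirc_gt0|lra|].
apply/andP; split.
  have [r [u [ru ct st]]] := polar_coordinates (cos t) (sin t) 0.
  have r1 : `|r| = 1.
    have : r ^+ 2 == 1.
      by rewrite -(cos2Dsin2 t) ct st !exprMn -mulrDr cos2Dsin2 mulr1.
    by rewrite sqrf_eq1 => /orP[] /eqP ->; rewrite ?normrN normr1.
  rewrite {2}/pcirc ct st pnormZ r1 mul1r; apply: mc.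
  by move: ru; rewrite in_itv/= sub0r add0r.
apply: (le_trans (NK _ _)); have := cos_max t; have := sin_max t; nra.
Qed.

(** The determinant of the unit vectors of angles s and t, which is twice the
    signed area of the triangle that they span with the origin. *)
Definition sector (R : realType) (N : planar_norm R) (s t : R) : R :=
  sin (t - s) / (pcirc N s * pcirc N t).

Lemma pcircV_lipschitz (R : realType) (N : planar_norm R) :
  lipschitz_fun (fun t => (pcirc N t)^-1).
Proof.
have [K K0 NK] := pcirc_lipschitz N; have [m [M [m0 _ mM]]] := pcirc_bounds N.
exists (m^-1 ^+ 2 * K) => [|s t]; first by rewrite mulr_ge0// sqr_ge0.
have /andP[ms _] := mM s; have /andP[mt _] := mM t.
rewrite (le_trans (inv_dist_le m0 ms mt))// -[leRHS]mulrA.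
by rewrite ler_wpM2l ?sqr_ge0.
Qed.

(** The integral starts at a - 1 so that every point of [a, b] is interior. *)
Lemma sector_density_primitive (R : realType) (N : planar_norm R) (a b : R) :
  exists G : R -> R, forall t : R, a <= t <= b ->
    is_derive t 1 G ((pcirc N t)^-1 ^+ 2).
Proof.
pose f t := (pcirc N t)^-1 ^+ 2.
have cf : continuous f.
  by move=> t; apply: cvgM; exact: (lipschitz_continuous (pcircV_lipschitz N)).
pose G x := (\int[@lebesgue_measure R]_(t in [set` `[a - 1, x]]) f t)%R.
exists G => t /andP[at_ tb].
have tb1 : t < b + 1 by lra.
have at1 : a - 1 < t by lra.
have fi : (@lebesgue_measure R).-integrable `[a - 1, b + 1] (EFin \o f).
  apply: continuous_compact_integrable; first exact: segment_compact.
  exact: continuous_subspaceT.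
have [dG G'] := @continuous_FTC1_closed R f (a - 1) t (b + 1) tb1 fi at1 (cf t).
by apply: DeriveDef; [exact: dG|rewrite -derive1E; exact: G'].
Qed.

(** The mean value theorem without an order between the end points, which is
    the form in which curves that may turn back use it. *)
Lemma MVT_unordered (R : realType) (f df : R -> R) (a b s t : R) :
  (forall x : R, a <= x <= b -> is_derive x 1 f (df x)) ->
  a <= s <= b -> a <= t <= b ->
  exists x, [/\ a <= x <= b, `|x - s| <= `|t - s|, `|x - t| <= `|t - s|
    & f t - f s = df x * (t - s)].
Proof.
move=> fdf.
wlog st : s t / s <= t => [hw|] sab tab.
  have [/hw|ts] := leP s t; first exact.
  have [x [xab xs xt e]] := hw t s (ltW ts) tab sab.
  by exists x; split; rewrite // 1?[`|t - s|]distrC// -opprB e; ring.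
have /andP[sa sb] := sab; have /andP[ta tb] := tab.
have d x : x \in `]s, t[ -> is_derive x 1 f (df x).
  by rewrite in_itv/= => /andP[sx xt]; apply: fdf; apply/andP; split; lra.
have [|x xst e] := MVT_segment st d.
  apply: derivable_within_continuous => x; rewrite in_itv/= => /andP[sx xt].
  have /fdf[] // : a <= x <= b by apply/andP; split; lra.
move: xst; rewrite in_itv/= => /andP[sx xt].
exists x; split; first by apply/andP; split; lra.
- by rewrite !ger0_norm ?subr_ge0// lerD2r.
- by rewrite distrC !ger0_norm ?subr_ge0// lerD2l lerN2.
- exact: e.
Qed.

(** [G] is twice the area swept in the unit ball. Inscribed triangles
    approximate it to second order because both sin u - u and the variation of
    the density [1 / pcirc N t ^ 2] are controlled; the increment of [G] over a
    half-turn is constant because that density has period pi. *)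
Lemma sector_primitive (R : realType) (N : planar_norm R) (a b : R) :
  a + pi <= b ->
  exists G : R -> R, exists C, exists A,
    [/\ 0 <= C, 0 < A,
      forall s t, a <= s <= b -> a <= t <= b ->
        `|sector N s t - (G t - G s)| <= C * (s - t) ^+ 2,
      forall s t, a <= s -> s <= t -> t <= b -> G s <= G t
    & forall t, a <= t -> t + pi <= b -> G (t + pi) = G t + A].
Proof.
move=> ab; have [G dG] := sector_density_primitive N a b.
have pi0 := pi_gt0 R.
have [K K0 nK] := pcircV_lipschitz N; have [m [M [m0 _ mM]]] := pcirc_bounds N.
pose v t := (pcirc N t)^-1.
have v0 t : 0 < v t by rewrite invr_gt0 pcirc_gt0.
have vm t : v t <= m^-1.
  by rewrite lef_pV2 ?posrE ?pcirc_gt0; have /andP[] := mM t.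
have mV0 : 0 < m^-1 by rewrite invr_gt0.
exists G, (m^-1 ^+ 2 + 2 * (K * m^-1)), (G (a + pi) - G a); split.
- by rewrite addr_ge0 ?sqr_ge0// mulr_ge0// mulr_ge0// ltW.
- have [||x [_ _ _ ->]] := @MVT_unordered _ G _ a b a (a + pi) dG.
  + by apply/andP; split; lra.
  + by apply/andP; split; lra.
  by rewrite mulr_gt0// ?exprn_gt0 ?invr_gt0 ?pcirc_gt0//; lra.
- move=> s t sab tab.
  have [x [xab xs xt ->]] := MVT_unordered dG sab tab.
  have -> : sector N s t - (pcirc N x)^-1 ^+ 2 * (t - s) =
      v s * v t * (sin (t - s) - (t - s))
      + (t - s) * ((v s - v x) * v t + v x * (v t - v x)).
    rewrite /sector /v; have := pcirc_gt0 N s; have := pcirc_gt0 N t.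
    have := pcirc_gt0 N x => x0 t0 s0; field; by rewrite !gt_eqF.
  apply: (le_trans (ler_normD _ _)); rewrite [leRHS]mulrDl lerD//.
    have -> : (s - t) ^+ 2 = (t - s) ^+ 2 by ring.
    rewrite normrM ler_pM//; last exact: sin_sub_id_le.
    by rewrite normrM !gtr0_norm// expr2 ler_pM// ltW.
  rewrite normrM -[(s - t) ^+ 2]real_normK ?num_real// (distrC s t) expr2.
  have -> : 2 * (K * m^-1) * (`|t - s| * `|t - s|) =
    `|t - s| * (K * `|t - s| * m^-1 + m^-1 * (K * `|t - s|)) by ring.
  rewrite ler_wpM2l// (le_trans (ler_normD _ _))// !normrM.
  rewrite (gtr0_norm (v0 t)) (gtr0_norm (v0 x)).
  have vsx : `|v s - v x| <= K * `|t - s|.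
    by rewrite (le_trans (nK _ _))// ler_wpM2l// distrC.
  have vtx : `|v t - v x| <= K * `|t - s|.
    by rewrite (le_trans (nK _ _))// ler_wpM2l// distrC.
  by rewrite lerD// ler_pM// ltW.
- move=> s t as_ st tb.
  have [||x [_ _ _ e]] := @MVT_unordered _ G _ a b s t dG.
  + by apply/andP; split; lra.
  + by apply/andP; split; lra.
  by rewrite -subr_ge0 e mulr_ge0 ?sqr_ge0 ?subr_ge0.
- move=> t at_ tb.
  have dH : forall x : R, a <= x <= b - pi ->
      is_derive x 1 (fun x => G (x + pi) - G x) 0.
    move=> x /andP[ax xb].
    have d1 : is_derive (x + pi : R) 1 G ((pcirc N x)^-1 ^+ 2).
      by rewrite -pcirc_pi; apply: dG; apply/andP; split; lra.
    have d2 : is_derive x 1 G ((pcirc N x)^-1 ^+ 2).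
      by apply: dG; apply/andP; split; lra.
    have d3 : is_derive x 1 (fun x : R => x + pi) 1.
      by rewrite -[X in is_derive _ _ _ X]addr0; apply: is_deriveD.
    have d4 := @is_derive1_comp _ G (fun x : R => x + pi) x _ _ d1 d3.
    have := @is_deriveB _ _ _ _ _ _ _ _ _ d4 d2.
    by rewrite mulr1 subrr.
  have [||x [_ _ _]] := @MVT_unordered _ _ _ a (b - pi) a t dH.
  + by apply/andP; split; lra.
  + by apply/andP; split; lra.
  by rewrite mul0r => /eqP; rewrite subr_eq add0r => /eqP h; rewrite -h; ring.
Qed.

(** * Orthogonal pairs of directions *)

(** The direction of angle [be] is Birkhoff orthogonal to that of angle [al]
    and lies on its counterclockwise side. Neither vector is normalized, since
    the condition only depends on the directions. *)
Definition orthogonal_angles (R : realType) (N : planar_norm R) (al be : R) :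
    Prop :=
  [/\ al < be, be < al + pi &
    forall t, pcirc N al <= N (cos al + t * cos be) (sin al + t * sin be)].

Lemma orthogonal_angles_sin_gt0 (R : realType) (N : planar_norm R) al be :
  orthogonal_angles N al be -> 0 < sin (be - al).
Proof. by case=> ab ba _; apply: sin_gt0_pi; apply/andP; split; lra. Qed.

Lemma orthogonal_angles_pi (R : realType) (N : planar_norm R) al be :
  orthogonal_angles N al be -> orthogonal_angles N (al + pi) (be + pi).
Proof.
case=> ab ba h; split; [lra|lra|move=> t].
rewrite pcirc_pi !cosDpi !sinDpi; have := h t.
by rewrite -pnormN; congr (_ <= N _ _); ring.
Qed.

(** The line through the unit vector of angle [al] in the direction [be]
    supports the unit ball, so the linear form v |-> v ^ (cos be, sin be)
    attains its maximum over the ball there. *)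
Lemma orthogonal_angles_support (R : realType) (N : planar_norm R) al be :
  orthogonal_angles N al be ->
  forall t, sin (be - t) * pcirc N al <= sin (be - al) * pcirc N t.
Proof.
move=> o t; have s0 := orthogonal_angles_sin_gt0 o; case: o => _ _ h.
have [st|st] := leP (sin (be - t)) 0.
  apply: (@le_trans _ _ 0); last by rewrite mulr_ge0 ?pnorm_ge0// ltW.
  by rewrite mulr_le0_ge0 ?pnorm_ge0.
have := ler_wpM2l (ltW st) (h (sin (t - al) / sin (be - t))).
move=> /le_trans; apply.
rewrite -[X in X * N _ _]gtr0_norm// -pnormZ.
have hs : sin (be - t) != 0 by rewrite gt_eqF.
rewrite -[X in _ <= X * _](gtr0_norm s0) -pnormZ le_eqVlt; apply/orP; left.
rewrite !mulrDr !mulrA.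
have e (x : R) :
    sin (be - t) * sin (t - al) / sin (be - t) * x = sin (t - al) * x.
  by field.
by apply/eqP; rewrite 2!e !sinB; congr (N _ _); ring.
Qed.

(** As x advances, so does its supporting direction. If not, multiplying the
    two support inequalities contradicts the Pluecker relation between the four
    directions. *)
Lemma orthogonal_angles_mono (R : realType) (N : planar_norm R) al be al' be' :
  orthogonal_angles N al be -> orthogonal_angles N al' be' ->
  al < al' -> be <= be'.
Proof.
move=> o o' aa'; have [//|bb'] := leP be be'.
have h := orthogonal_angles_support o al'.
have h' := orthogonal_angles_support o' al.
case: o o' => ab ba _ [ab' ba' _].
have s1 : 0 < sin (be - al') by apply: sin_gt0_pi; apply/andP; split; lra.
have s2 : 0 < sin (be' - al) by apply: sin_gt0_pi; apply/andP; split; lra.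
have s3 : 0 < sin (al' - al) by apply: sin_gt0_pi; apply/andP; split; lra.
have s4 : 0 < sin (be - be') by apply: sin_gt0_pi; apply/andP; split; lra.
have s5 : 0 < sin (be' - al') by apply: sin_gt0_pi; apply/andP; split; lra.
have n0 := pcirc_gt0 N al; have n0' := pcirc_gt0 N al'.
have plucker : sin (be - al') * sin (be' - al) =
    sin (be - al) * sin (be' - al') + sin (al' - al) * sin (be - be').
  by rewrite !sinB; ring.
have : (sin (be - al') * pcirc N al) * (sin (be' - al) * pcirc N al') <=
       (sin (be - al) * pcirc N al') * (sin (be' - al') * pcirc N al).
  by rewrite ler_pM// mulr_ge0// ltW.
have -> : (sin (be - al') * pcirc N al) * (sin (be' - al) * pcirc N al') =
  (sin (be - al) * sin (be' - al') + sin (al' - al) * sin (be - be')) *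
    (pcirc N al * pcirc N al') by rewrite -plucker; ring.
have -> : (sin (be - al) * pcirc N al') * (sin (be' - al') * pcirc N al) =
  (sin (be - al) * sin (be' - al')) * (pcirc N al * pcirc N al') by ring.
rewrite ler_pM2r ?mulr_gt0// gerDl leNgt mulr_gt0//.
Qed.

(** An order on the sums of the angles orders each angle: they cannot move in
    opposite directions by monotonicity, nor both decrease. In particular the
    sum determines the pair. *)
Lemma orthogonal_angles_le (R : realType) (N : planar_norm R) al be al' be' :
  orthogonal_angles N al be -> orthogonal_angles N al' be' ->
  al + be <= al' + be' -> al <= al' /\ be <= be'.
Proof.
move=> o o' ss'.
have m := orthogonal_angles_mono o o'; have m' := orthogonal_angles_mono o' o.
split; first by rewrite leNgt; apply/negP => /[dup] /m' h1 h2; lra.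
rewrite leNgt; apply/negP => bb'.
by have [/m h|h] := ltP al al'; lra.
Qed.

(** The support inequality against the unit vector perpendicular to [be] keeps
    the two directions uniformly away from being parallel. *)
Lemma orthogonal_angles_sin_ge (R : realType) (N : planar_norm R) :
  exists2 k, 0 < k & forall al be, orthogonal_angles N al be ->
    k <= sin (be - al).
Proof.
have [m [M [m0 M0 mM]]] := pcirc_bounds N.
exists (m / M) => [|al be o]; first exact: divr_gt0.
have := orthogonal_angles_support o (be - pi / 2).
rewrite opprB addrCA subrr addr0 sin_pihalf mul1r ler_pdivrMr// => h.
have s0 := orthogonal_angles_sin_gt0 o.
have /andP[mal _] := mM al; have /andP[_ bM] := mM (be - pi / 2).
by rewrite (le_trans mal)// (le_trans h)// ler_wpM2l// ltW.
Qed.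

(** A convex function of t that stays above a function with a flat maximum of
    the same value at t = 0 has its minimum at 0: a smaller value at t would
    force a decrease of first order near 0. *)
Lemma pnorm_line_min (R : realType) (N : planar_norm R) a b c d :
  (forall t, `|t| <= 1 ->
    (N a b) ^+ 2 * (1 - t ^+ 2) <= (N (a + t * c) (b + t * d)) ^+ 2) ->
  forall t, N a b <= N (a + t * c) (b + t * d).
Proof.
move=> h t; have n0 := pnorm_ge0 N a b.
set P := N a b in n0 h *; set Q := N (a + t * c) (b + t * d).
have Q0 : 0 <= Q by exact: pnorm_ge0.
rewrite leNgt; apply/negP => QP.
have P0 : 0 < P by lra.
pose u := (P - Q) / P; have u0 : 0 < u by rewrite divr_gt0// subr_gt0.
have u1 : u <= 1 by rewrite ler_pdivrMr// mul1r; lra.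
(* For small tau the chord from 0 to t has height P (1 - tau u) at tau t, below
   P sqrt (1 - (tau t)^2) as soon as tau (t^2 + u^2) < 2 u. *)
pose tau := u / (1 + t ^+ 2 + u ^+ 2).
have D0 : 0 < 1 + t ^+ 2 + u ^+ 2 by have := sqr_ge0 t; have := sqr_ge0 u; lra.
have tau0 : 0 < tau by rewrite divr_gt0.
have tauD : tau * (1 + t ^+ 2 + u ^+ 2) = u by rewrite divfK ?gt_eqF.
have t2 := sqr_ge0 t; have uu := sqr_ge0 u.
have tau1 : tau <= 1 by rewrite ler_pdivrMr// mul1r; lra.
have taut : `|tau * t| <= 1.
  rewrite -(@ler_pXn2r _ 2) ?nnegrE// expr1n real_normK ?num_real// exprMn.
  by nra.
have := h _ taut.
have : N (a + tau * t * c) (b + tau * t * d) <= (1 - tau) * P + tau * Q.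
  have := pnormD N ((1 - tau) * a) ((1 - tau) * b)
    (tau * (a + t * c)) (tau * (b + t * d)).
  rewrite !pnormZ (gtr0_norm tau0) ger0_norm ?subr_ge0// -/P -/Q.
  by move=> e; apply: le_trans e; rewrite le_eqVlt; apply/orP; left; apply/eqP;
    congr (N _ _); ring.
have -> : (1 - tau) * P + tau * Q = P * (1 - tau * u).
  by rewrite /u; field; rewrite gt_eqF.
move=> h1 h2.
have : P ^+ 2 * (1 - (tau * t) ^+ 2) <= P ^+ 2 * (1 - tau * u) ^+ 2.
  rewrite (le_trans h2)// -exprMn.
  by rewrite ler_pXn2r ?nnegrE ?pnorm_ge0// (le_trans _ h1) ?pnorm_ge0.
rewrite ler_pM2l ?exprn_gt0//; nra.
Qed.

(** Let S be the reflection that maps angle t to s - t. The pair is (x, S x) up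
    to scaling, where x maximizes the quadratic form v ^ S v over the unit
    ball: as S x ^ x = - (x ^ S x), the form takes the value (1 - t^2) (x ^ S
    x) at x + t S x, so maximality gives |x + t S x|^2 >= 1 - t^2, and
    [pnorm_line_min] applies. In polar form v ^ S v over |v|^2 is the function
    [q] below. *)
Lemma orthogonal_angles_exist (R : realType) (N : planar_norm R) (s : R) :
  exists al, orthogonal_angles N al (s - al).
Proof.
have pi0 := pi_gt0 R.
pose q t := sin (s - 2 * t) * (pcirc N t)^-1 ^+ 2.
have hle : s / 2 - pi / 2 <= s / 2 + pi / 2 by lra.
have cq : continuous q.
  move=> t; apply: cvgM; last first.
    by apply: cvgM; exact: (lipschitz_continuous (pcircV_lipschitz N)).
  apply: (@lipschitz_continuous _ (fun t => sin (s - 2 * t))).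
  have [L L0 sL] := sin_lipschitz R; exists (L * 2) => [|x y]; first lra.
  rewrite (le_trans (sL _ _))//.
  have -> : s - 2 * x - (s - 2 * y) = 2 * (y - x) by ring.
  by rewrite normrM normr_nat mulrA distrC.
have [al] := EVT_max hle (continuous_subspaceT cq).
rewrite in_itv/= => /andP[al1 al2] qmax.
have q0 : 0 < q al.
  have /qmax : s / 2 - pi / 4 \in `[s / 2 - pi / 2, s / 2 + pi / 2].
    by rewrite in_itv/=; apply/andP; split; lra.
  apply: lt_le_trans; rewrite /q.
  have -> : s - 2 * (s / 2 - pi / 4) = pi / 2 by field.
  by rewrite sin_pihalf mul1r exprn_gt0// invr_gt0 pcirc_gt0.
have n0 := pcirc_gt0 N al.
have s0 : 0 < sin (s - 2 * al).
  by move: q0; rewrite /q pmulr_lgt0// exprn_gt0// invr_gt0.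
have [s1 s2] : 0 < s - 2 * al /\ s - 2 * al < pi.
  split; rewrite ltNge; apply/negP => h.
    have : 0 <= sin (- (s - 2 * al)).
      by apply: sin_ge0_pi; apply/andP; split; lra.
    by rewrite sinN; lra.
  by have [e] : s - 2 * al = pi by [lra|]; move: s0; rewrite e sinpi ltxx.
exists al; split; [lra|lra|].
apply: pnorm_line_min => t t1; rewrite -/(pcirc N al).
have t2 : t ^+ 2 <= 1.
  rewrite -real_normK ?num_real// -[X in _ <= X](expr1n _ 2).
  by rewrite ler_pXn2r ?nnegrE.
set a := cos al + _; set b := sin al + _.
have [r [u [us ea eb]]] := polar_coordinates a b (s / 2).
have /qmax : u \in `[s / 2 - pi / 2, s / 2 + pi / 2] by rewrite in_itv.
have nu := pcirc_gt0 N u.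
have Nab : N a b ^+ 2 = r ^+ 2 * pcirc N u ^+ 2.
  by rewrite ea eb pnormZ exprMn real_normK ?num_real.
have wedge : r ^+ 2 * sin (s - 2 * u) = sin (s - 2 * al) * (1 - t ^+ 2).
  pose be := s - al; have sE : s = al + be by rewrite /be; ring.
  have -> : s - 2 * u = s - (u + u) by ring.
  have -> : s - 2 * al = be - al by rewrite /be; ring.
  rewrite sinB cosD sinD.
  have -> : r ^+ 2 * (sin s * (cos u * cos u - sin u * sin u) -
      cos s * (sin u * cos u + cos u * sin u)) =
      sin s * (a ^+ 2 - b ^+ 2) - 2 * cos s * a * b by rewrite ea eb; ring.
  rewrite sE sinD cosD sinB /a /b -/be.
  have -> : (sin al * cos be + cos al * sin be) *
    ((cos al + t * cos be) ^+ 2 - (sin al + t * sin be) ^+ 2) -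
    2 * (cos al * cos be - sin al * sin be) * (cos al + t * cos be) *
    (sin al + t * sin be) =
    (sin be * cos al - cos be * sin al) * ((cos al ^+ 2 + sin al ^+ 2) -
      t ^+ 2 * (cos be ^+ 2 + sin be ^+ 2)) by ring.
  by rewrite !cos2Dsin2 mulr1.
rewrite /q !exprVn ler_pdivrMr ?exprn_gt0// mulrAC.
rewrite ler_pdivlMr ?exprn_gt0// => h.
rewrite -(ler_pM2l s0).
have -> : sin (s - 2 * al) * (pcirc N al ^+ 2 * (1 - t ^+ 2)) =
    r ^+ 2 * (sin (s - 2 * u) * pcirc N al ^+ 2).
  by rewrite [RHS]mulrA wedge; ring.
have -> : sin (s - 2 * al) * N a b ^+ 2 =
    r ^+ 2 * (sin (s - 2 * al) * pcirc N u ^+ 2) by rewrite Nab; ring.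
by apply: ler_wpM2l; [exact: sqr_ge0|exact: h].
Qed.

(** * Tangent chords of a larger sphere *)

(** [(ux N t, uy N t)] is the unit vector of angle [t]. *)
Definition ux (R : realType) (N : planar_norm R) (t : R) := cos t / pcirc N t.
Definition uy (R : realType) (N : planar_norm R) (t : R) := sin t / pcirc N t.

Lemma pnorm_u (R : realType) (N : planar_norm R) t : N (ux N t) (uy N t) = 1.
Proof.
have n0 := pcirc_gt0 N t.
rewrite /ux /uy mulrC (mulrC (sin t)) pnormZ gtr0_norm ?invr_gt0//.
by rewrite mulVf// gt_eqF.
Qed.

Lemma u_pi (R : realType) (N : planar_norm R) t :
  ux N (t + pi) = - ux N t /\ uy N (t + pi) = - uy N t.
Proof. by rewrite /ux /uy pcirc_pi cosDpi sinDpi !mulNr. Qed.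

Lemma sectorE (R : realType) (N : planar_norm R) s t :
  sector N s t = ux N s * uy N t - uy N s * ux N t.
Proof.
have ns := pcirc_gt0 N s; have nt := pcirc_gt0 N t.
by rewrite /sector /ux /uy sinB; field; rewrite !gt_eqF.
Qed.

Lemma sector_support (R : realType) (N : planar_norm R) al be t :
  orthogonal_angles N al be -> sector N t be <= sector N al be.
Proof.
move=> /orthogonal_angles_support /(_ t) h.
have n0 := pcirc_gt0 N al; have nb := pcirc_gt0 N be; have nt := pcirc_gt0 N t.
rewrite /sector ler_pdivrMr ?mulr_gt0// mulrAC ler_pdivlMr ?mulr_gt0//.
by have := ler_wpM2r (ltW nb) h; rewrite -!mulrA.
Qed.

Definition ray_norm (R : realType) (N : planar_norm R) (al be r : R) : R :=
  N (ux N al + r * ux N be) (uy N al + r * uy N be).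

Definition chord (R : realType) (N : planar_norm R) (c al be r : R) : Prop :=
  [/\ orthogonal_angles N al be, 0 < r & ray_norm N al be r = c].

Lemma pnorm_ray_convex (R : realType) (N : planar_norm R) a b c d r s :
  N a b = 1 -> 0 <= s -> s <= r -> 0 < r ->
  r * (N (a + s * c) (b + s * d) - 1) <= s * (N (a + r * c) (b + r * d) - 1).
Proof.
move=> ab s0 sr r0.
have := pnormD N ((1 - s / r) * a) ((1 - s / r) * b)
  ((s / r) * (a + r * c)) ((s / r) * (b + r * d)).
have s1 : s / r <= 1 by rewrite ler_pdivrMr// mul1r.
have s2 : 0 <= s / r by rewrite divr_ge0// ltW.
rewrite !pnormZ !ger0_norm ?subr_ge0// ab mulr1.
have -> : (1 - s / r) * a + s / r * (a + r * c) = a + s * c.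
  by field; rewrite gt_eqF.
have -> : (1 - s / r) * b + s / r * (b + r * d) = b + s * d.
  by field; rewrite gt_eqF.
move=> h; have := ler_wpM2l (ltW r0) h.
have -> : r * (1 - s / r + s / r * N (a + r * c) (b + r * d)) =
  r - s + s * N (a + r * c) (b + r * d) by field; rewrite gt_eqF.
lra.
Qed.

(** Convexity gives the norm slope at least (C - 1) / r' where the second ray
    leaves the ball of radius C, so a perturbation of the ray changes its
    length in proportion. *)
Lemma ray_length_stable (R : realType) (N : planar_norm R) C a b c d r
    a' b' c' d' r' : 1 < C ->
  N a b = 1 -> N a' b' = 1 -> 0 < r -> 0 < r' ->
  N (a + r * c) (b + r * d) = C -> N (a' + r' * c') (b' + r' * d') = C ->
  `|r - r'| * (C - 1) <= r' * (N (a - a') (b - b') + r * N (c - c') (d - d')).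
Proof.
move=> C1 ab ab' r0 r0' h h'.
pose f := N (a' + r * c') (b' + r * d').
have fC : `|f - C| <= N (a - a') (b - b') + r * N (c - c') (d - d').
  rewrite -h distrC (le_trans (pnorm_dist _ _ _ _ _))//.
  have -> : r * N (c - c') (d - d') = N (r * (c - c')) (r * (d - d')).
    by rewrite pnormZ gtr0_norm.
  apply: le_trans (pnormD _ _ _ _ _).
  by rewrite le_eqVlt; apply/orP; left; apply/eqP; congr (N _ _); ring.
rewrite (@le_trans _ _ (r' * `|f - C|))//; last by rewrite ler_wpM2l// ltW.
have [rr'|r'r] := leP r r'.
  have := pnorm_ray_convex c' d' ab' (ltW r0) rr' r0'.
  rewrite h' -/f ler0_norm ?subr_le0// => h2.
  have f2 : - (f - C) <= `|f - C| by rewrite -normrN ler_norm.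
  by have := ler_wpM2l (ltW r0') f2; nra.
have := pnorm_ray_convex c' d' ab' (ltW r0') (ltW r'r) r0.
rewrite h' -/f gtr0_norm ?subr_gt0// => h2.
by have := ler_wpM2l (ltW r0') (ler_norm (f - C)); nra.
Qed.

Lemma ray_norm_bounds (R : realType) (N : planar_norm R) al be r :
  `|r| - 1 <= ray_norm N al be r <= 1 + `|r|.
Proof.
have e : N (r * ux N be) (r * uy N be) = `|r| by rewrite pnormZ pnorm_u mulr1.
apply/andP; split.
  rewrite -e; have := pnormD N (ux N al + r * ux N be) (uy N al + r * uy N be)
    (- ux N al) (- uy N al).
  have -> : ux N al + r * ux N be + - ux N al = r * ux N be by ring.
  have -> : uy N al + r * uy N be + - uy N al = r * uy N be by ring.
  by rewrite pnormN pnorm_u /ray_norm; lra.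
by rewrite /ray_norm (le_trans (pnormD _ _ _ _ _))// pnorm_u e.
Qed.

Lemma ray_norm_lip (R : realType) (N : planar_norm R) al be r s :
  `|ray_norm N al be r - ray_norm N al be s| <= `|r - s|.
Proof.
rewrite (le_trans (pnorm_dist _ _ _ _ _))//.
rewrite -[leRHS]mulr1 -(pnorm_u N be) -pnormZ.
by rewrite le_eqVlt; apply/orP; left; apply/eqP; congr (N _ _); ring.
Qed.

(** Intermediate values: the norm is 1 at the start of the ray and at least c
    at distance c + 1. *)
Lemma chord_exists (R : realType) (N : planar_norm R) c al be : 1 < c ->
  orthogonal_angles N al be -> exists r, chord N c al be r.
Proof.
move=> c1 o.
have cf : continuous (ray_norm N al be).
  apply: lipschitz_continuous; exists 1 => // x y; rewrite mul1r.
  exact: ray_norm_lip.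
have f0 : ray_norm N al be 0 = 1 by rewrite /ray_norm !mul0r !addr0 pnorm_u.
have /andP[f1 _] := ray_norm_bounds N al be (c + 1).
have c0 : 0 <= c + 1 by lra.
rewrite ger0_norm// addrK in f1.
have [|r] := @IVT _ _ 0 (c + 1) c c0 (continuous_subspaceT cf).
  by rewrite f0 ge_min le_max f1 (ltW c1) orbT.
rewrite in_itv/= => /andP[r0 _] fr; exists r; split => //.
rewrite lt_neqAle r0 andbT; apply/eqP => r0'.
by move: fr; rewrite -r0' f0; lra.
Qed.

Lemma chord_pi (R : realType) (N : planar_norm R) c al be r :
  chord N c al be r -> chord N c (al + pi) (be + pi) r.
Proof.
case=> o r0 h; split=> //; first exact: orthogonal_angles_pi.
rewrite -h /ray_norm; have [-> ->] := u_pi N al; have [-> ->] := u_pi N be.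
by rewrite -pnormN; congr (N _ _); ring.
Qed.

Lemma chord_unique (R : realType) (N : planar_norm R) c al be r r' : 1 < c ->
  chord N c al be r -> chord N c al be r' -> r = r'.
Proof.
move=> c1 [_ r0 h] [_ r0' h'].
have := ray_length_stable c1 (pnorm_u N al) (pnorm_u N al) r0 r0' h h'.
rewrite !subrr pnorm0 mulr0 addr0 mulr0 pmulr_lle0 ?subr_gt0//.
by rewrite normr_le0 subr_eq0 => /eqP.
Qed.

(** The polar angle of the end point z = x + r y of a chord. It is written with
    the arctangent of the quotient of the coordinates of z along (cos al, sin
    al) and its perpendicular, the second of which is bounded below: this makes
    a continuous choice of the angle and shows that it is Lipschitz. *)
Definition chord_angle (R : realType) (N : planar_norm R) (al be r : R) : R :=
  al + pi / 2 - atan (((pcirc N al)^-1 + r / pcirc N be * cos (be - al)) /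
                      (r / pcirc N be * sin (be - al))).

Lemma chord_angleP (R : realType) (N : planar_norm R) c al be r :
  chord N c al be r ->
  ux N al + r * ux N be = c * ux N (chord_angle N al be r) /\
  uy N al + r * uy N be = c * uy N (chord_angle N al be r).
Proof.
case=> o r0 h; have s0 := orthogonal_angles_sin_gt0 o.
have na := pcirc_gt0 N al; have nb := pcirc_gt0 N be.
rewrite /chord_angle; set p := _^-1 + _; set q := r / _ * _.
have q0 : 0 < q by rewrite mulr_gt0// divr_gt0.
set u := atan _; set g := al + _ - u.
have cu : 0 < cos u by apply: cos_gt0_pihalf; rewrite atan_gtNpi2 atan_ltpi2.
have qp : q / cos u * sin u = p.
  have : tan u = p / q by exact: atanK.
  by rewrite /tan mulrAC -mulrA => ->; rewrite mulrCA divff ?mulr1// gt_eqF.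
have gE : g = (al - u) + pi / 2 by rewrite /g; ring.
have cE : cos g = cos al * sin u - sin al * cos u.
  by rewrite gE cosDpihalf sinB; ring.
have sE : sin g = sin al * sin u + cos al * cos u.
  by rewrite gE sinDpihalf cosB; ring.
have cb : cos be = cos (be - al) * cos al - sin (be - al) * sin al.
  by rewrite -cosD subrK.
have sb : sin be = sin (be - al) * cos al + cos (be - al) * sin al.
  by rewrite -sinD subrK.
have e1 : ux N al + r * ux N be = q / cos u * cos g.
  rewrite cE mulrBr [q / _ * (cos al * _)]mulrCA qp.
  have -> : q / cos u * (sin al * cos u) = q * sin al by field; rewrite gt_eqF.
  by rewrite /ux cb /p /q; ring.
have e2 : uy N al + r * uy N be = q / cos u * sin g.
  rewrite sE mulrDr [q / _ * (sin al * _)]mulrCA qp.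
  have -> : q / cos u * (cos al * cos u) = q * cos al by field; rewrite gt_eqF.
  by rewrite /uy sb /p /q; ring.
have e3 : c = q / cos u * pcirc N g.
  by rewrite -h /ray_norm e1 e2 pnormZ gtr0_norm// divr_gt0.
have ng := pcirc_gt0 N g.
by rewrite e1 e2 e3 /ux /uy; split; field; rewrite !gt_eqF.
Qed.

Lemma chord_angle_bounds (R : realType) (N : planar_norm R) al be r :
  al < chord_angle N al be r < al + pi.
Proof.
rewrite /chord_angle; set u := atan _.
have h1 : - (pi / 2) < u := atan_gtNpi2 _.
have h2 : u < pi / 2 := atan_ltpi2 _.
by apply/andP; split; lra.
Qed.

(** * Mamikon's area identity *)

(** Here [B] is the sector area swept by y, and [E] is c^2 times the one swept
    by z, minus the one swept by x, minus r (x ^ y). The third clause is the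
    identity dE = r^2 dB, with r^2 replaced by the product of the two values of
    r, and the last one evaluates it over the half-turn from (x, y) to (-x,
    -y), which is the increment 2 pi of s. *)
Lemma chord_area (R : realType) (N : planar_norm R) (c : R) : 1 < c ->
  exists (al be r E B : R -> R) (A : R),
  [/\ forall s, chord N c (al s) (be s) (r s),
      forall s t, 0 <= s -> s <= t -> t <= 2 * pi -> B s <= B t,
      quad_on 0 (2 * pi) (fun s t => E t - E s - r s * r t * (B t - B s)),
      0 < A & E (2 * pi) - E 0 = (c ^+ 2 - 1) * A /\ B (2 * pi) - B 0 = A].
Proof.
move=> c1; have pi0 := pi_gt0 R.
have /choice[al oal] := orthogonal_angles_exist N.
pose be s := s - al s.
have /choice[r ch] : forall s, exists r, chord N c (al s) (be s) r.
  by move=> s; apply: chord_exists.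
have albe s : al s + be s = s by rewrite /be; ring.
have mono s t : s <= t -> al s <= al t /\ be s <= be t.
  by move=> st; apply: (orthogonal_angles_le (oal s) (oal t)); rewrite !albe.
(* Two nondecreasing functions with sum s are 1-Lipschitz. *)
have lal : lip_on 0 (2 * pi) al.
  exists 1 => // s t _ _; rewrite mul1r.
  wlog st : s t / s <= t => [hw|].
    by have /orP[/hw//|/hw] := le_total s t; rewrite distrC (distrC t).
  have [h1 h2] := mono _ _ st; have := albe s; have := albe t.
  by rewrite !ler0_norm ?subr_le0//; lra.
have lbe : lip_on 0 (2 * pi) be.
  apply: lip_onD; last exact: lip_onN.
  by apply: lipschitz_lip_on; exists 1 => // x y; rewrite mul1r.
have lcos (f : R -> R) : lip_on 0 (2 * pi) f ->
    lip_on 0 (2 * pi) (fun s => cos (f s)).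
  by move=> lf; exact: (lip_on_comp (cos_lipschitz R) lf).
have lsin (f : R -> R) : lip_on 0 (2 * pi) f ->
    lip_on 0 (2 * pi) (fun s => sin (f s)).
  by move=> lf; exact: (lip_on_comp (sin_lipschitz R) lf).
have lnV (f : R -> R) : lip_on 0 (2 * pi) f ->
    lip_on 0 (2 * pi) (fun s => (pcirc N (f s))^-1).
  by move=> lf; exact: (lip_on_comp (pcircV_lipschitz N) lf).
have lux (f : R -> R) : lip_on 0 (2 * pi) f ->
    lip_on 0 (2 * pi) (fun s => ux N (f s)).
  by move=> lf; apply: lip_onM; [exact: lcos|exact: lnV].
have luy (f : R -> R) : lip_on 0 (2 * pi) f ->
    lip_on 0 (2 * pi) (fun s => uy N (f s)).
  by move=> lf; apply: lip_onM; [exact: lsin|exact: lnV].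
have r0 s : 0 < r s by case: (ch s).
have rc s : c - 1 <= r s <= c + 1.
  have [_ _ h] := ch s; have := ray_norm_bounds N (al s) (be s) (r s).
  by rewrite h gtr0_norm// => /andP[h1 h2]; apply/andP; split; lra.
have lr : lip_on 0 (2 * pi) r.
  have [K K0 NK] := pnorm_le_coords N.
  have [K1 K10 l1] := lux _ lal; have [K2 K20 l2] := luy _ lal.
  have [K3 K30 l3] := lux _ lbe; have [K4 K40 l4] := luy _ lbe.
  pose L := (c + 1) * (K * (K1 + K2) + (c + 1) * (K * (K3 + K4))).
  have L0 : 0 <= L.
    by rewrite /L mulr_ge0 ?addr_ge0 ?mulr_ge0 ?addr_ge0//; lra.
  exists (L / (c - 1)) => [|s t sI tI]; first by rewrite divr_ge0//; lra.
  rewrite mulrAC ler_pdivlMr ?subr_gt0//.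
  have [_ _ hs] := ch s; have [_ _ ht] := ch t.
  have := ray_length_stable c1 (pnorm_u N _) (pnorm_u N _) (r0 s) (r0 t) hs ht.
  move=> /le_trans; apply.
  have /andP[_ rs] := rc s; have /andP[_ rt] := rc t.
  have d1 : N (ux N (al s) - ux N (al t)) (uy N (al s) - uy N (al t)) <=
      K * (K1 + K2) * `|s - t|.
    by rewrite (le_trans (NK _ _))// -mulrA ler_wpM2l// mulrDl lerD ?l1 ?l2.
  have d2 : N (ux N (be s) - ux N (be t)) (uy N (be s) - uy N (be t)) <=
      K * (K3 + K4) * `|s - t|.
    by rewrite (le_trans (NK _ _))// -mulrA ler_wpM2l// mulrDl lerD ?l3 ?l4.
  have -> : L * `|s - t| = (c + 1) * (K * (K1 + K2) * `|s - t| +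
      (c + 1) * (K * (K3 + K4) * `|s - t|)) by rewrite /L; ring.
  have rs0 := ltW (r0 s); have rt0 := ltW (r0 t).
  by rewrite ler_pM ?addr_ge0 ?mulr_ge0 ?pnorm_ge0// lerD// ler_pM ?pnorm_ge0.
pose ga s := chord_angle N (al s) (be s) (r s).
have lga : lip_on 0 (2 * pi) ga.
  have [k k0 sk] := orthogonal_angles_sin_ge N.
  have [m [M [m0 M0 mM]]] := pcirc_bounds N.
  have lrb : lip_on 0 (2 * pi) (fun s => r s / pcirc N (be s)).
    by apply: lip_onM; [exact: lr|exact: lnV].
  have ldif : lip_on 0 (2 * pi) (fun s => be s - al s).
    by apply: lip_onD; [exact: lbe|exact: lip_onN].
  apply: lip_onD; first by apply: lip_onD; [exact: lal|exact: lip_on_cst].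
  apply: lip_onN; apply: (lip_on_comp (atan_lipschitz R)); apply: lip_onM.
    by apply: lip_onD; [exact: lnV|apply: lip_onM; [exact: lrb|exact: lcos]].
  apply: (@lip_onV _ _ _ ((c - 1) / M * k)).
  - by rewrite mulr_gt0// divr_gt0// subr_gt0.
  - move=> s _; have /andP[rs _] := rc s; have /andP[_ nM] := mM (be s).
    rewrite ler_pM ?(ltW k0) ?sk ?divr_ge0 ?subr_ge0 ?(ltW c1) ?(ltW M0)//.
    rewrite ler_pM ?invr_ge0 ?subr_ge0 ?(ltW c1) ?(ltW M0)//.
    by rewrite lef_pV2 ?posrE ?pcirc_gt0.
  - by apply: lip_onM; [exact: lrb|exact: lsin].
have aI s : 0 <= s <= 2 * pi -> - pi <= al s <= 3 * pi.
  move=> /andP[s0 s2]; have [h1 h2 _] := oal s.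
  by apply/andP; split; lra.
have bI s : 0 <= s <= 2 * pi -> - pi <= be s <= 3 * pi.
  move=> /andP[s0 s2]; have [h1 h2 _] := oal s; rewrite /be.
  by apply/andP; split; lra.
have gI s : 0 <= s <= 2 * pi -> - pi <= ga s <= 3 * pi.
  move=> /andP[s0 s2]; have [h1 h2 _] := oal s.
  have := chord_angle_bounds N (al s) (be s) (r s).
  rewrite -/(ga s) => /andP[h3 h4].
  by apply/andP; split; lra.
have hab : - pi + pi <= 3 * pi :> R by lra.
have [G [C [A [C0 A0 GC Gm GA]]]] := sector_primitive N hab.
pose k s := r s * sector N (al s) (be s).
exists al, be, r, (fun s => c ^+ 2 * G (ga s) - G (al s) - k s).
exists (fun s => G (be s)), A.
have I0 : (0 : R) <= (0 : R) <= 2 * @pi R by apply/andP; split; lra.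
have I2 : (0 : R) <= (2 * @pi R : R) <= 2 * @pi R by apply/andP; split; lra.
have period : [/\ al (2 * pi) = al 0 + pi, be (2 * pi) = be 0 + pi
    & r (2 * pi) = r 0].
  have o := orthogonal_angles_pi (oal 0).
  have sumE : al (2 * pi) + be (2 * pi) = al 0 + pi + (be 0 + pi).
    by rewrite albe addrACA albe; ring.
  have [|a1 b1] := orthogonal_angles_le (oal (2 * pi)) o.
    by rewrite -sumE.
  have [|a2 b2] := orthogonal_angles_le o (oal (2 * pi)).
    by rewrite -sumE.
  have ae : al (2 * pi) = al 0 + pi by apply/eqP; rewrite eq_le a1.
  have eb : be (2 * pi) = be 0 + pi by apply/eqP; rewrite eq_le b1.
  split => //; apply: (chord_unique c1 (ch _)).
  by rewrite ae eb; exact: chord_pi.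
split => //.
- move=> s t s0 st t2; apply: Gm.
  + have /bI/andP[] // : 0 <= s <= 2 * pi by apply/andP; split; lra.
  + by have [] := mono _ _ st.
  + have /bI/andP[] // : 0 <= t <= 2 * pi by apply/andP; split; lra.
- have q1 : quad_on 0 (2 * pi) (fun s t =>
      sector N (ga s) (ga t) - (G (ga t) - G (ga s))).
    exact: (quad_on_comp C0 GC gI lga).
  have q2 : quad_on 0 (2 * pi) (fun s t =>
      sector N (al s) (al t) - (G (al t) - G (al s))).
    exact: (quad_on_comp C0 GC aI lal).
  have q3 : quad_on 0 (2 * pi) (fun s t =>
      sector N (be s) (be t) - (G (be t) - G (be s))).
    exact: (quad_on_comp C0 GC bI lbe).
  (* The determinant of the increments of x and y. *)
  have q4 : quad_on 0 (2 * pi) (fun s t =>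
      (ux N (al t) - ux N (al s)) * (uy N (be t) - uy N (be s)) +
      (-1) * ((uy N (al t) - uy N (al s)) * (ux N (be t) - ux N (be s)))).
    apply: quad_onD.
      by apply: (quad_on_lip (lux _ lal) (luy _ lbe)).
    apply: (quad_onM (h := fun _ _ => -1)); last first.
      by apply: (quad_on_lip (luy _ lal) (lux _ lbe)).
    by exists 1 => // s t _ _; rewrite normrN1.
  have supp s t : sector N (al t) (be s) - sector N (al s) (be s) <= 0.
    by rewrite subr_le0; apply: sector_support.
  (* The support inequalities at s and at t say that dx ^ y is nonpositive for y
     at s and nonnegative for y at t.  Their difference is dx ^ dy, which bounds
     both: this is the discrete form of dx being parallel to y. *)
  have q5 : quad_on 0 (2 * pi) (fun s t =>
      sector N (al t) (be s) - sector N (al s) (be s)).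
    apply: quad_on_le q4 => s t _ _.
    have h1 := supp s t; have h2 := supp t s.
    set d := (X in _ <= `|X|).
    have -> : d = (sector N (al t) (be t) - sector N (al s) (be t)) -
        (sector N (al t) (be s) - sector N (al s) (be s)).
      by rewrite /d !sectorE; ring.
    by rewrite ler0_norm// ger0_norm; lra.
  have q6 : quad_on 0 (2 * pi) (fun s t =>
      sector N (al t) (be t) - sector N (al s) (be t)).
    apply: quad_on_le q4 => s t _ _.
    have h1 := supp s t; have h2 := supp t s.
    set d := (X in _ <= `|X|).
    have -> : d = (sector N (al t) (be t) - sector N (al s) (be t)) -
        (sector N (al t) (be s) - sector N (al s) (be s)).
      by rewrite /d !sectorE; ring.
    by rewrite !ger0_norm; lra.
  have rB s : `|- r s| <= c + 1.
    by rewrite normrN gtr0_norm//; have /andP[] := rc s.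
  have c0 : 0 <= c + 1 by lra.
  have q : quad_on 0 (2 * pi) (fun s t =>
      - c ^+ 2 * (sector N (ga s) (ga t) - (G (ga t) - G (ga s))) +
      ((sector N (al s) (al t) - (G (al t) - G (al s))) +
       ((r s * r t) * (sector N (be s) (be t) - (G (be t) - G (be s))) +
        (- r s * (sector N (al t) (be s) - sector N (al s) (be s)) +
         - r t * (sector N (al t) (be t) - sector N (al s) (be t)))))).
    apply: quad_onD.
      by apply: (quad_onM (h := fun _ _ => - c ^+ 2)) q1; exists `|- c ^+ 2|.
    apply: (quad_onD q2); apply: quad_onD.
      apply: (quad_onM (h := fun s t => r s * r t)) q3.
      exists ((c + 1) * (c + 1)) => [|s t _ _].
        exact: mulr_ge0.
      by rewrite -mulrNN normrM ler_pM.
    apply: quad_onD.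
      by apply: (quad_onM (h := fun s _ => - r s)) q5; exists (c + 1).
    by apply: (quad_onM (h := fun _ t => - r t)) q6; exists (c + 1).
  apply: quad_on_le q => s t _ _; rewrite le_eqVlt; apply/orP; left; apply/eqP.
  congr `|_|; rewrite /k.
  have z s' : ux N (al s') + r s' * ux N (be s') = c * ux N (ga s') /\
              uy N (al s') + r s' * uy N (be s') = c * uy N (ga s').
    exact: chord_angleP (ch s').
  (* The determinant of z at s and z at t, expanded along z = x + r y. *)
  have zE : c ^+ 2 * sector N (ga s) (ga t) =
      sector N (al s) (al t) + r s * r t * sector N (be s) (be t) +
      (r t * sector N (al s) (be t) - r s * sector N (al t) (be s)).
    have -> : c ^+ 2 * sector N (ga s) (ga t) =
        (c * ux N (ga s)) * (c * uy N (ga t)) -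
        (c * uy N (ga s)) * (c * ux N (ga t)) by rewrite sectorE; ring.
    have [<- <-] := z s; have [<- <-] := z t.
    by rewrite !sectorE; ring.
  by rewrite [X in _ = X + _]mulrBr mulNr zE; ring.
- have [ae eb re] := period.
  have ge : ga (2 * pi) = ga 0 + pi.
    rewrite /ga /chord_angle ae eb re !pcirc_pi.
    have -> : be 0 + pi - (al 0 + pi) = be 0 - al 0 by ring.
    by ring.
  have ke : k (2 * pi) = k 0.
    rewrite /k re /sector ae eb !pcirc_pi.
    by have -> : be 0 + pi - (al 0 + pi) = be 0 - al 0 by ring.
  have /andP[a1 _] := aI _ I0; have /andP[_ a2] := aI _ I2.
  have /andP[b1 _] := bI _ I0; have /andP[_ b2] := bI _ I2.
  have /andP[g1 _] := gI _ I0; have /andP[_ g2] := gI _ I2.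
  rewrite ge ke ae eb !GA -?ae -?eb -?ge//.
  by split; ring.
Qed.

Lemma chord_lower_bound (R : realType) (N : planar_norm R) (c rho : R) :
  1 < c -> 0 <= rho ->
  (forall al be r, chord N c al be r -> rho <= r) -> 1 + rho ^+ 2 <= c ^+ 2.
Proof.
move=> c1 rho0 H; have pi0 := pi_gt0 R.
have [al [be [r [E [B [A [ch Bm [C C0 EC] A0 [EA BA]]]]]]]] := chord_area N c1.
have pp : 0 <= 2 * pi :> R by lra.
have := @le_of_quadratic_defect _ _ _ C (fun s => E s - rho ^+ 2 * B s) pp C0.
have step s t : 0 <= s -> s <= t -> t <= 2 * pi ->
    - (C * (s - t) ^+ 2) <= (E t - rho ^+ 2 * B t) - (E s - rho ^+ 2 * B s).
  move=> s0 st t2.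
  have /EC/(_ _)h : 0 <= s <= 2 * pi by apply/andP; split; lra.
  have /h : 0 <= t <= 2 * pi by apply/andP; split; lra.
  rewrite ler_norml => /andP[h1 _].
  have Bst := Bm _ _ s0 st t2.
  have rr : rho ^+ 2 <= r s * r t by rewrite expr2 ler_pM// (H _ _ _ (ch _)).
  have : 0 <= (r s * r t - rho ^+ 2) * (B t - B s).
    by rewrite mulr_ge0 ?subr_ge0.
  lra.
move=> /(_ step) h.
have Bq : B (2 * pi) = B 0 + A by rewrite -BA; ring.
have Eq : E (2 * pi) = E 0 + (c ^+ 2 - 1) * A by rewrite -EA; ring.
have : 0 <= (c ^+ 2 - 1 - rho ^+ 2) * A by move: h; rewrite Bq Eq; lra.
by rewrite pmulr_lge0//; lra.
Qed.

Lemma chord_upper_bound (R : realType) (N : planar_norm R) (c rho : R) :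
  1 < c ->
  (forall al be r, chord N c al be r -> r <= rho) -> c ^+ 2 <= 1 + rho ^+ 2.
Proof.
move=> c1 H; have pi0 := pi_gt0 R.
have [al [be [r [E [B [A [ch Bm [C C0 EC] A0 [EA BA]]]]]]]] := chord_area N c1.
have pp : 0 <= 2 * pi :> R by lra.
have := @le_of_quadratic_defect _ _ _ C (fun s => rho ^+ 2 * B s - E s) pp C0.
have step s t : 0 <= s -> s <= t -> t <= 2 * pi ->
    - (C * (s - t) ^+ 2) <= (rho ^+ 2 * B t - E t) - (rho ^+ 2 * B s - E s).
  move=> s0 st t2.
  have /EC/(_ _)h : 0 <= s <= 2 * pi by apply/andP; split; lra.
  have /h : 0 <= t <= 2 * pi by apply/andP; split; lra.
  rewrite ler_norml => /andP[_ h1].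
  have Bst := Bm _ _ s0 st t2.
  have [_ rs _] := ch s; have [_ rt _] := ch t.
  have rr : r s * r t <= rho ^+ 2.
    by rewrite expr2 ler_pM ?(H _ _ _ (ch _))// ltW.
  have : 0 <= (rho ^+ 2 - r s * r t) * (B t - B s).
    by rewrite mulr_ge0 ?subr_ge0.
  lra.
move=> /(_ step) h.
have Bq : B (2 * pi) = B 0 + A by rewrite -BA; ring.
have Eq : E (2 * pi) = E 0 + (c ^+ 2 - 1) * A by rewrite -EA; ring.
have : 0 <= (1 + rho ^+ 2 - c ^+ 2) * A by move: h; rewrite Bq Eq; lra.
by rewrite pmulr_lge0//; lra.
Qed.

Lemma ray_norm_orthogonal_ge1 (R : realType) (N : planar_norm R) al be t :
  orthogonal_angles N al be -> 1 <= ray_norm N al be t.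
Proof.
case=> _ _ h; have na := pcirc_gt0 N al; have nb := pcirc_gt0 N be.
have := h (t * pcirc N al / pcirc N be).
have -> : cos al + t * pcirc N al / pcirc N be * cos be =
    pcirc N al * (ux N al + t * ux N be).
  by rewrite /ux; field; rewrite !gt_eqF.
have -> : sin al + t * pcirc N al / pcirc N be * sin be =
    pcirc N al * (uy N al + t * uy N be).
  by rewrite /uy; field; rewrite !gt_eqF.
by rewrite pnormZ gtr0_norm// -/(ray_norm N al be t) ler_pMr.
Qed.

(** If every value were larger than c + d, every chord would be shorter than
    eps by a fixed amount, against [chord_upper_bound]. The amount is cut off
    at eps to keep eps - d' nonnegative. *)
Lemma exists_orthogonal_le (R : realType) (N : planar_norm R) (eps d : R) :
  0 < eps -> 0 < d -> exists al be, orthogonal_angles N al be /\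
    ray_norm N al be eps <= Num.sqrt (1 + eps ^+ 2) + d.
Proof.
move=> e0 d0; set c := Num.sqrt _.
have e2 : 0 < eps ^+ 2 by rewrite exprn_gt0.
have c2 : c ^+ 2 = 1 + eps ^+ 2 by rewrite sqr_sqrtr//; lra.
have c0 : 0 <= c by exact: sqrtr_ge0.
have c1 : 1 < c by rewrite ltNge; apply/negP => c1; nra.
apply: contrapT => hn.
have H al be : orthogonal_angles N al be -> c + d < ray_norm N al be eps.
  by move=> o; rewrite ltNge; apply/negP => h; apply: hn; exists al, be.
pose d' := Num.min d eps.
have d'0 : 0 < d' by rewrite lt_min d0.
have d'd : d' <= d by rewrite ge_min lexx.
have d'e : d' <= eps by rewrite ge_min lexx orbT.
have : c ^+ 2 <= 1 + (eps - d') ^+ 2.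
  apply: (chord_upper_bound c1) => al be r [hab r0 h].
  have Ho := H _ _ hab.
  have re : r < eps.
    rewrite ltNge; apply/negP => er.
    have := pnorm_ray_convex (ux N be) (uy N be) (pnorm_u N al) (ltW e0) er r0.
    rewrite -/(ray_norm N al be eps) -/(ray_norm N al be r) h => h2.
    have : r * (c - 1) < r * (ray_norm N al be eps - 1).
      by rewrite ltr_pM2l//; lra.
    have : eps * (c - 1) <= r * (c - 1) by rewrite ler_wpM2r//; lra.
    lra.
  have := ray_norm_lip N al be eps r; rewrite h !ger0_norm; lra.
rewrite c2; nra.
Qed.

Lemma exists_orthogonal_ge (R : realType) (N : planar_norm R) (eps d : R) :
  0 < eps -> 0 < d -> exists al be, orthogonal_angles N al be /\
    Num.sqrt (1 + eps ^+ 2) - d <= ray_norm N al be eps.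
Proof.
move=> e0 d0; set c := Num.sqrt _.
have e2 : 0 < eps ^+ 2 by rewrite exprn_gt0.
have c2 : c ^+ 2 = 1 + eps ^+ 2 by rewrite sqr_sqrtr//; lra.
have c0 : 0 <= c by exact: sqrtr_ge0.
have c1 : 1 < c by rewrite ltNge; apply/negP => c1; nra.
apply: contrapT => hn.
have H al be : orthogonal_angles N al be -> ray_norm N al be eps < c - d.
  by move=> o; rewrite ltNge; apply/negP => h; apply: hn; exists al, be.
have ed : 0 <= eps + d by lra.
have : 1 + (eps + d) ^+ 2 <= c ^+ 2.
  apply: (chord_lower_bound c1 ed) => al be r [hab r0 h].
  have Ho := H _ _ hab.
  have er : eps < r.
    rewrite ltNge; apply/negP => re.
    have := pnorm_ray_convex (ux N be) (uy N be) (pnorm_u N al) (ltW r0) re e0.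
    rewrite -/(ray_norm N al be eps) -/(ray_norm N al be r) h => h2.
    have : r * (ray_norm N al be eps - 1) <= eps * (ray_norm N al be eps - 1).
      by rewrite ler_wpM2r// subr_ge0 ray_norm_orthogonal_ge1.
    have : eps * (ray_norm N al be eps - 1) < eps * (c - 1).
      by rewrite ltr_pM2l//; lra.
    lra.
  have := ray_norm_lip N al be r eps; rewrite h !ger0_norm; lra.
rewrite c2; nra.
Qed.

(** * Sublinear functionals and the Hahn-Banach theorem *)

Definition sublinear (R : realType) (V : lmodType R) (q : V -> R) : Prop :=
  (forall u v, q (u + v) <= q u + q v) /\
  (forall t v, 0 <= t -> q (t *: v) = t * q v).

Lemma sublinear0 (R : realType) (V : lmodType R) (q : V -> R) :
  sublinear q -> q 0 = 0.
Proof. by move=> [_ /(_ 0 0 (lexx _))]; rewrite scale0r mul0r. Qed.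

Lemma sublinear_oppr_le (R : realType) (V : lmodType R) (q : V -> R) v :
  sublinear q -> - q (- v) <= q v.
Proof.
by move=> qs; have := qs.1 v (- v); rewrite subrr (sublinear0 qs); lra.
Qed.

(** Descents and lower bounds of chains are both pointwise infima of sublinear
    functionals; the universal property is what proves them sublinear. *)
Lemma sublinear_infimum (R : realType) (V : lmodType R) (I : Type)
    (D : set I) (f : I -> V -> R) (low : V -> R) :
  D !=set0 -> (forall i v, D i -> low v <= f i v) ->
  exists g : V -> R, (forall i v, D i -> g v <= f i v) /\
    (forall m v, (forall i, D i -> m <= f i v) -> m <= g v).
Proof.
move=> [i0 Di0] flow.
exists (fun v => inf [set f i v | i in D]); split => [i v Di|m v mf].
  apply: ge_inf; last by exists i.
  by exists (low v) => _ [j Dj <-]; exact: flow.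
apply: lb_le_inf; first by exists (f i0 v), i0.
by move=> _ [j Dj <-]; exact: mf.
Qed.

Lemma sublinear_of_le (R : realType) (V : lmodType R) (q : V -> R) :
  (forall u v, q (u + v) <= q u + q v) ->
  (forall t v, 0 < t -> q (t *: v) <= t * q v) -> q 0 = 0 -> sublinear q.
Proof.
move=> qD qZ q0; split=> // t v; rewrite le_eqVlt => /predU1P[<-|t0].
  by rewrite scale0r mul0r.
apply/eqP; rewrite eq_le qZ//= mulrC -ler_pdivlMr// mulrC.
have := qZ t^-1 (t *: v); rewrite invr_gt0 scalerA mulVf ?gt_eqF// scale1r.
exact.
Qed.

(** The functional q'(v) = inf over t >= 0 of q (v + t w) - t c. The term t = 1
    at v = - w gives q'(- w) <= - c, and c <= q w keeps the infimum finite. *)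
Lemma sublinear_descent (R : realType) (V : lmodType R) (q : V -> R) w c :
  sublinear q -> c <= q w ->
  exists q' : V -> R, [/\ sublinear q', forall v, q' v <= q v, q' (- w) <= - c &
    forall m v, (forall t, 0 <= t -> m <= q (v + t *: w) - t * c) -> m <= q' v].
Proof.
move=> qs cw; have [qD qZ] := qs.
have [||q' [q'le q'ge]] := @sublinear_infimum R V R [set t | 0 <= t]
  (fun t v => q (v + t *: w) - t * c) (fun v => - q (- v)).
- by exists 0; rewrite /= lexx.
- move=> t v /= t0; have := qD (v + t *: w) (- v).
  have -> : v + t *: w - v = t *: w by rewrite addrAC subrr add0r.
  have := ler_wpM2l t0 cw; rewrite qZ//; lra.
have le0 v : q' v <= q v.
  by have := q'le 0 v (lexx _); rewrite scale0r addr0 mul0r subr0.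
exists q'; split => //; last first.
  have := q'le 1 (- w) ler01.
  by rewrite scale1r addNr (sublinear0 qs) mul1r sub0r.
apply: sublinear_of_le.
- move=> u v; rewrite -lerBlDr; apply: (q'ge) => t t0.
  rewrite lerBlDr -lerBlDl; apply: (q'ge) => t' t0'.
  have := q'le (t + t') (u + v) (addr_ge0 t0 t0').
  have := qD (u + t *: w) (v + t' *: w).
  rewrite addrACA -scalerDl; lra.
- move=> t v t0; rewrite -ler_pdivrMl//; apply: (q'ge) => s s0.
  rewrite ler_pdivrMl//; have := q'le (t * s) (t *: v) (mulr_ge0 (ltW t0) s0).
  by rewrite -scalerA -scalerDr qZ ?(ltW t0)// mulrBr mulrA.
- apply/eqP; rewrite eq_le; apply/andP; split.
    by rewrite -[leRHS](sublinear0 qs).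
  apply: (q'ge) => t t0; rewrite add0r qZ// -mulrBr mulr_ge0// subr_ge0//.
Qed.

(** Zorn's lemma: the pointwise infimum of a chain is sublinear because any two
    members are comparable, and it is finite because a sublinear functional q
    below p satisfies q v >= - q (- v) >= - p (- v). *)
Lemma sublinear_minimal (R : realType) (V : lmodType R) (p : V -> R) :
  sublinear p -> exists q : V -> R, [/\ sublinear q, forall v, q v <= p v &
    forall q' : V -> R, sublinear q' -> (forall v, q' v <= q v) -> q' = q].
Proof.
move=> ps; pose P (q : V -> R) := sublinear q /\ forall v, q v <= p v.
pose T := {q : V -> R | P q}.
pose below (q1 q2 : T) : bool := `[< forall v, sval q2 v <= sval q1 v >].
have [| | |A tot|[q [qs qp]] qmin] := @Zorn T below.
- by move=> q; apply/asboolP => v.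
- move=> q1 q2 q3 /asboolP h1 /asboolP h2; apply/asboolP => v.
  exact: le_trans (h2 v) (h1 v).
- move=> [q1 h1] [q2 h2] /asboolP /= le1 /asboolP /= le2.
  by apply: eq_exist; apply/funext => v; apply/eqP; rewrite eq_le le1 le2.
- have [[q0 Aq0]|An] := pselect (A !=set0); last first.
    exists (exist _ p (conj ps (fun v => lexx _))) => q Aq.
    by exfalso; apply: An; exists q.
  have [||g [gle gge]] := @sublinear_infimum R V T A (fun q => sval q)
    (fun v => - p (- v)).
  + by exists q0.
  + move=> [q [qs qp]] v _ /=; apply: le_trans (sublinear_oppr_le v qs).
    by rewrite lerN2.
  have gs : sublinear g.
    apply: sublinear_of_le.
    * move=> u v; rewrite -lerBlDr; apply: (gge) => q1 Aq1.
      rewrite lerBlDr -lerBlDl; apply: (gge) => q2 Aq2; rewrite lerBlDl.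
      case: (tot q1 q2 Aq1 Aq2) => /asboolP le12.
        apply: (le_trans (gle q2 _ Aq2)).
        apply: (le_trans ((svalP q2).1.1 _ _)).
        by rewrite lerD2r.
      apply: (le_trans (gle q1 _ Aq1)); apply: (le_trans ((svalP q1).1.1 _ _)).
      by rewrite lerD2l.
    * move=> t v t0; rewrite -ler_pdivrMl//; apply: (gge) => q Aq.
      by rewrite ler_pdivrMl// -((svalP q).1.2 _ _ (ltW t0)); exact: gle.
    * apply/eqP; rewrite eq_le; apply/andP; split.
        by have := gle q0 0 Aq0; rewrite (sublinear0 (svalP q0).1).
      by apply: (gge) => q Aq; rewrite (sublinear0 (svalP q).1).
  have gp v : g v <= p v.
    by apply: (le_trans (gle q0 v Aq0)); exact: (svalP q0).2.
  by exists (exist _ g (conj gs gp)) => q Aq; apply/asboolP => v /=; exact: gle.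
exists q; split=> // q' qs' q'q.
have q'p v : q' v <= p v by apply: le_trans (q'q v) (qp v).
have := qmin (exist _ q' (conj qs' q'p)).
by move=> /(_ (asboolT q'q)) /(congr1 sval).
Qed.

(** A minimal sublinear functional q is linear: minimality makes it equal to
    its own descent along w with c = q w, so q (- w) <= - q w, and an odd
    sublinear functional is additive. *)
Lemma sublinear_dominates_linear (R : realType) (V : lmodType R) (p : V -> R) :
  sublinear p -> exists f : {linear V -> R^o}, forall v, f v <= p v.
Proof.
move=> ps; have [q [qs qp qmin]] := sublinear_minimal ps.
have qN w : q (- w) = - q w.
  have [q' [qs' q'q q'w _]] := sublinear_descent qs (lexx (q w)).
  rewrite (qmin _ qs' q'q) in q'w.
  by have := sublinear_oppr_le w qs; lra.
have ql : linear (q : V -> R^o).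
  have qD u v : q (u + v) = q u + q v.
    apply/eqP; rewrite eq_le qs.1/=.
    by have := qs.1 (- u) (- v); rewrite -opprD !qN; lra.
  move=> a u v; rewrite qD; congr (_ + _).
  have [a0|a0] := leP 0 a; first by rewrite qs.2.
  rewrite -[a]opprK scaleNr qN qs.2 ?oppr_ge0 ?ltW//.
  by rewrite scaleNr.
pose Q : {linear V -> R^o} :=
  HB.pack (q : V -> R^o) (GRing.isLinear.Build R V R^o *:%R q ql).
by exists Q.
Qed.

(** Three descents from the norm force a dominated linear functional f to
    satisfy f x >= 1, f y >= 0 and f y <= 0. The hypothesis is what makes the
    second and third descents possible: it says that the first one is
    nonnegative on the line of y. *)
Lemma birkhoff_quasi_orthogonal (R : realType) (X : normedModType R) (x y : X) :
  `|x| = 1 -> (forall t : R, 1 <= `|x + t *: y|) -> quasi_orthogonal x y.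
Proof.
move=> x1 xy.
have ns : sublinear (fun v : X => `|v|).
  by split=> [u v|t v t0]; [exact: ler_normD|rewrite normrZ ger0_norm].
have [|q1 [s1 le1 q1x q1ge]] := @sublinear_descent _ _ _ x 1 ns.
  by rewrite x1.
have q1y s : 0 <= q1 (s *: y).
  apply: (q1ge) => t; rewrite le_eqVlt mulr1 subr_ge0 => /predU1P[<-|t0].
    exact: normr_ge0.
  have -> : s *: y + t *: x = t *: (x + (s / t) *: y).
    by rewrite scalerDr scalerA addrC mulrCA divff ?mulr1// gt_eqF.
  by rewrite normrZ gtr0_norm// ler_pMr.
have [|q2 [s2 le2 q2y q2ge]] := @sublinear_descent _ _ _ y 0 s1.
  by rewrite -[y]scale1r.
have [|q3 [s3 le3 q3y _]] := @sublinear_descent _ _ _ (- y) 0 s2.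
  apply: (q2ge) => t t0; rewrite mulr0 subr0.
  by have -> : - y + t *: y = (t - 1) *: y by rewrite scalerBl scale1r addrC.
have [f f3] := sublinear_dominates_linear s3.
have fn v : f v <= `|v|.
  by rewrite (le_trans (f3 v))// (le_trans (le3 v))// (le_trans (le2 v)).
have fabs v : `|f v| <= `|v|.
  rewrite ler_norml fn andbT lerNl.
  by have := fn (- v); rewrite linearN normrN.
have fx : f x = `|x|.
  apply/eqP; rewrite eq_le fn x1/= -lerN2 -linearN.
  by rewrite (le_trans (f3 _))// (le_trans (le3 _))// (le_trans (le2 _)).
have fy : f y = 0.
  apply/eqP; rewrite eq_le; apply/andP; split.
    by rewrite (le_trans (f3 _))//; move: q3y; rewrite opprK oppr0.
  rewrite -oppr_le0 -linearN (le_trans (f3 _))// (le_trans (le3 _))//.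
  by move: q2y; rewrite oppr0.
exists f; split => //.
- apply: bounded_linear_continuous; apply/bounded_funP => r.
  by exists r => v vr; exact: le_trans (fabs v) vr.
- rewrite /functional_norm; set S := [set _ | _ in _].
  have S1 : S 1 by exists x; rewrite /= ?x1// fx x1 normr1.
  have ub : ubound S 1 by move=> _ [v v1 <-]; exact: le_trans (fabs v) v1.
  apply/eqP; rewrite eq_le; apply/andP; split.
    by apply: ge_sup => //; exists 1.
  by apply: ub_le_sup => //; exists 1.
Qed.

(** * The moduli of a normed space *)

Lemma planar_norm_of_pair (R : realType) (X : normedModType R) (u v : X) :
  (forall a b : R, a *: u + b *: v = 0 -> a = 0 /\ b = 0) ->
  exists N : planar_norm R, forall a b, N a b = `|a *: u + b *: v|.
Proof.
move=> uv.
have nD a b c d : `|(a + c) *: u + (b + d) *: v| <=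
    `|a *: u + b *: v| + `|c *: u + d *: v|.
  by rewrite !scalerDl addrACA ler_normD.
have nZ t a b : `|(t * a) *: u + (t * b) *: v| = `|t| * `|a *: u + b *: v|.
  by rewrite -!scalerA -scalerDr normrZ.
have n0 a b : `|a *: u + b *: v| = 0 -> a = 0 /\ b = 0.
  by move/eqP; rewrite normr_eq0 => /eqP; exact: uv.
by exists (PlanarNorm nD nZ n0).
Qed.

Lemma dim_geq2 (R : realType) (X : normedModType R) : dim_geq X 2 ->
  exists u v : X, forall a b : R, a *: u + b *: v = 0 -> a = 0 /\ b = 0.
Proof.
move=> [e he]; exists (e ord0), (e ord_max) => a b ab.
have := he (fun i => if i == ord0 then a else b).
rewrite big_ord_recl big_ord1 /=.
have -> : lift ord0 ord0 = ord_max :> 'I_2 by apply/val_inj.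
by move=> /(_ ab) h; split; [exact: (h ord0)|exact: (h ord_max)].
Qed.

(** Reduction to the plane spanned by two independent vectors. *)
Lemma zeta_set_planar (R : realType) (X : normedModType R) (eps : R) :
  dim_geq X 2 -> exists N : planar_norm R, forall al be,
    orthogonal_angles N al be -> zeta_set X eps (ray_norm N al be eps).
Proof.
move=> /dim_geq2[u [v uv]]; have [N NE] := planar_norm_of_pair uv.
exists N => al be o.
have comb t : ux N al *: u + uy N al *: v + t *: (ux N be *: u + uy N be *: v) =
    (ux N al + t * ux N be) *: u + (uy N al + t * uy N be) *: v.
  by rewrite scalerDr !scalerA addrACA -!scalerDl.
exists (ux N al *: u + uy N al *: v), (ux N be *: u + uy N be *: v).
have x1 : `|ux N al *: u + uy N al *: v| = 1 by rewrite -NE pnorm_u.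
split => //.
- by rewrite /unit_sphere /= -NE pnorm_u.
- apply: birkhoff_quasi_orthogonal => // t.
  by rewrite comb -NE; exact: ray_norm_orthogonal_ge1.
- by rewrite comb -NE.
Qed.

Lemma zeta_set_bounds (R : realType) (X : normedModType R) (eps r : R) :
  0 < eps -> zeta_set X eps r -> 0 <= r <= 1 + eps.
Proof.
move=> e0 [x [y [x1 y1 _ ->]]].
rewrite normr_ge0/= (le_trans (ler_normD _ _))//.
by rewrite normrZ gtr0_norm// x1 y1 mulr1.
Qed.

Lemma zeta_minus_le (R : realType) (X : normedModType R) (eps : R) :
  dim_geq X 2 -> 0 < eps -> zeta_minus X eps <= Num.sqrt (1 + eps ^+ 2).
Proof.
move=> dX e0; have [N NZ] := zeta_set_planar eps dX.
apply/ler_addgt0Pr => d d0.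
have [al [be [albe le]]] := exists_orthogonal_le N e0 d0.
apply: le_trans le; apply: ge_inf; last exact: NZ.
by exists 0 => r /(zeta_set_bounds e0) /andP[].
Qed.

Lemma zeta_plus_ge (R : realType) (X : normedModType R) (eps : R) :
  dim_geq X 2 -> 0 < eps -> Num.sqrt (1 + eps ^+ 2) <= zeta_plus X eps.
Proof.
move=> dX e0; have [N NZ] := zeta_set_planar eps dX.
apply/ler_addgt0Pr => d d0; rewrite -lerBlDr.
have [al [be [albe ge]]] := exists_orthogonal_ge N e0 d0.
apply: (le_trans ge); apply: ub_le_sup; last exact: NZ.
by exists (1 + eps) => r /(zeta_set_bounds e0) /andP[].
Qed.

(** The functional p has norm 1, so |x + t y| >= p (x + t y) = p x. Norm 1 also
    excludes an unbounded p, for which the supremum would be 0. *)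
Lemma quasi_orthogonal_norm_ge (R : realType) (X : normedModType R) (x y : X) :
  quasi_orthogonal x y -> forall t : R, `|x| <= `|x + t *: y|.
Proof.
move=> [p [_ p1 px py]] t.
have pb v : p v <= `|v|.
  have [->|v0] := eqVneq v 0; first by rewrite linear0 normr0.
  have nv : 0 < `|v| by rewrite normr_gt0.
  rewrite -[leRHS]mulr1 -ler_pdivrMl//.
  rewrite -p1; apply: (@le_trans _ _ `|p (`|v|^-1 *: v)|).
    by rewrite linearZ; exact: ler_norm.
  apply: ub_le_sup.
    apply: contrapT => nb; suff : functional_norm p = 0.
      by rewrite p1 => /eqP; rewrite oner_eq0.
    by apply: sup_out => -[].
  exists (`|v|^-1 *: v) => //=.
  by rewrite normrZ gtr0_norm ?invr_gt0// mulVf ?gt_eqF.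
by rewrite -px -[p x]addr0 -(mulr0 t) -py -[t * p y]linearZ -linearD.
Qed.

(** If (x, y) were not 0, then 1 + 2 t (x, y) + t^2 would be smaller than 1 at
    t = - (x, y). *)
Lemma hilbert_zeta_set (R : realType) (H : completeNormedModType R)
    (eps r : R) :
  is_hilbert H -> zeta_set H eps r -> r = Num.sqrt (1 + eps ^+ 2).
Proof.
move=> [dot dotE] [x [y [x1 y1 xy ->]]].
have dC u v : dot u v = dot v u by have := hermC dot u v; rewrite expr0 mul1r.
have dxy t : dot (x + t *: y) (x + t *: y) =
    dot x x + 2 * t * dot x y + t ^+ 2 * dot y y.
  rewrite linearDl !linearDr /= !linearZl_LR !linearZ /= (dC y x).
  by rewrite /GRing.scale /=; ring.
have sq u : dot u u = `|u| ^+ 2.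
  rewrite dotE sqr_sqrtr//.
  have [->|u0] := eqVneq u 0; first by rewrite linear0r.
  exact/ltW/neq0_dnorm_gt0.
have n1 : dot x x = 1 by rewrite sq x1 expr1n.
have n2 : dot y y = 1 by rewrite sq y1 expr1n.
have o : dot x y = 0.
  have h t : 0 <= 2 * t * dot x y + t ^+ 2.
    have := quasi_orthogonal_norm_ge xy t; rewrite x1 => h.
    have : 1 <= dot (x + t *: y) (x + t *: y).
      by rewrite sq -[1](expr1n _ 2) ler_pXn2r ?nnegrE.
    by rewrite dxy n1 n2; lra.
  by have := h (- dot x y); nra.
by rewrite dotE dxy n1 n2 o; congr Num.sqrt; ring.
Qed.

Theorem theorem2 (R : realType) (X H : completeNormedModType R)
    (dimX : dim_geq X 2) (hilbH : is_hilbert H) (dimH : dim_geq H 2) (eps : R)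
    (eps_gt0 : 0 < eps) :
  [/\ zeta_minus X eps <= zeta_minus H eps,
      zeta_minus H eps = Num.sqrt (1 + eps ^+ 2),
      Num.sqrt (1 + eps ^+ 2) = zeta_plus H eps
    & zeta_plus H eps <= zeta_plus X eps].
Proof.
have [r Hr] : zeta_set H eps !=set0.
  have [N NZ] := zeta_set_planar eps dimH.
  have [al o] := orthogonal_angles_exist N 0.
  by exists (ray_norm N al (0 - al) eps); exact: NZ.
have HE : zeta_set H eps = [set Num.sqrt (1 + eps ^+ 2)].
  apply/seteqP; split=> [s /(hilbert_zeta_set hilbH)//|_ ->].
  by rewrite -(hilbert_zeta_set hilbH Hr).
rewrite /zeta_minus /zeta_plus HE inf1 sup1; split => //.
- exact: zeta_minus_le.
- exact: zeta_plus_ge.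
Qed.
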